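(* For the root system of type $\widetilde A_1$ with $n=2$, $$Z_{\omega_1}(\mathbf x;u)=\frac{1}{(ux_0;\mathbf x^{2\delta})_\infty\,(ux_1\mathbf x^\delta;\mathbf x^{2\delta})_\infty}.$$
   Context: $\widetilde A_1$ is the affine root system with generalized Cartan matrix $\begin{pmatrix}2&-2\\-2&2\end{pmatrix}$, simple roots $\alpha_0,\alpha_1$, Weyl group $W$ (infinite dihedral) generated by the simple reflections $\sigma_0,\sigma_1$, minimal positive imaginary root $\delta=\alpha_0+\alpha_1$, positive real roots $\Phi^+_{\rm re}=\{\alpha_i+k\delta\mid i=0,1,\ k\ge0\}$, and positive imaginary roots $k\delta$ ($k\ge1$), each of multiplicity 1. For $\lambda=k_0\alpha_0+k_1\alpha_1$, $\mathbf x^\lambda=x_0^{k_0}x_1^{k_1}$; in particular $\mathbf x^\delta=x_0x_1$. $\sigma_i\mathbf x$ is defined by $x_i\mapsto x_i^{-1}$, $x_{1-i}\mapsto x_{1-i}x_i^2$. $u$ is a parameter. The fundamental weight $\omega_1$ corresponds to the twisting parameters $l_0=0$, $l_1=1$. The Chinta-Gunnells action twisted by $\omega_1$ (for $n=2$, $g_1=u$, $q=u^2$) is the right action of $W$ on rational functions with $f\vert^{\mathrm{CG}}_{\omega_1}\sigma_0(\mathbf x)=\frac{1-u/x_0}{1-ux_0}f(\sigma_0\mathbf x)$ and $f\vert^{\mathrm{CG}}_{\omega_1}\sigma_1(\mathbf x)=f(\sigma_1\mathbf x)$; the related action is $f\vert_{\omega_1}\sigma_i=-x_i^2\cdot f\vert^{\mathrm{CG}}_{\omega_1}\sigma_i$.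 Set $\Delta(\mathbf x)=\prod_{\alpha\in\Phi^+_{\rm re}}(1-\mathbf x^{2\alpha})\prod_{k\ge1}(1-\mathbf x^{2k\delta})$ and $Z_{\omega_1}(\mathbf x;u)=\Delta(\mathbf x)^{-1}\sum_{\sigma\in W}1\vert_{\omega_1}\sigma(\mathbf x)$ (a power series in $x_0,x_1$ with coefficients polynomial in $u$). $(a;p)_\infty=\prod_{k\ge0}(1-ap^k)$. *)

(* Defs.v *)
From mathcomp Require Import all_boot all_order all_algebra.
From mathcomp Require Import fraction.
From mathcomp Require Import mpoly.

Set Implicit Arguments.
Unset Strict Implicit.
Unset Printing Implicit Defensive.

Import GRing.Theory.
Local Open Scope ring_scope.
Local Open Scope quotient_scope.

Notation "x %:F" := (@FracField.tofrac _ x).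

(* Roots.  An element k_0 alpha_0 + k_1 alpha_1 of the positive cone of the
   root lattice is the exponent vector (k_0, k_1) : 'X_{1..2}, so that the
   monomial x^lambda is 'X_[lambda]. *)

Definition delta : 'X_{1..2} := (U_(ord0) + U_(ord_max))%MM.

Definition real_root (ik : 'I_2 * nat) : 'X_{1..2} :=
  (U_(ik.1) + delta *+ ik.2)%MM.

(* The Weyl group.  [srefl i] is the matrix of sigma_i, in the basis of simple
   roots (column coordinates): sigma_i alpha_j = alpha_j - a_ij alpha_i. *)

Definition cartan : 'M[int]_2 := \matrix_(i, j) (if i == j then 2 else - 2).

Definition srefl (i : 'I_2) : 'M[int]_2 :=
  \matrix_(k, j) ((k == j)%:R - (k == i)%:R * cartan i j).

(* The word [:: i1; ...; ik] stands for sigma_i1 ... sigma_ik. *)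
Definition word_mx (s : seq 'I_2) : 'M[int]_2 := \prod_(i <- s) srefl i.

Definition word_eq (s t : seq 'I_2) : bool := word_mx s == word_mx t.

Lemma word_eq_refl : reflexive word_eq.
Proof. by move=> s; apply: eqxx. Qed.

Lemma word_eq_sym : ssrbool.symmetric word_eq.
Proof. by move=> s t; apply: eq_sym. Qed.

Lemma word_eq_trans : transitive word_eq.
Proof. by move=> t s r /eqP st /eqP tr; apply/eqP; rewrite st tr. Qed.

Canonical word_eq_equiv :=
  EquivRel word_eq word_eq_refl word_eq_sym word_eq_trans.

(* The group generated by sigma_0 and sigma_1: words in the simple reflections,
   two words being identified when they act in the same way on the root
   lattice. *)
Definition weyl := {eq_quot word_eq}.

Section RationalFunctions.
Variables (R : idomainType) (u : R).

(* The field of rational functions in x_0, x_1. *)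
Definition ratfun := {fraction {mpoly R[2]}}.

Definition cst (c : R) : ratfun := (c%:MP : {mpoly R[2]})%:F.

Definition var (i : 'I_2) : ratfun := ('X_i : {mpoly R[2]})%:F.

(* The tuple sigma_i x: x_i |-> x_i^-1 and x_(1-i) |-> x_(1-i) x_i^2. *)
Definition refl_var (i j : 'I_2) : ratfun :=
  if j == i then (var i)^-1 else var j * var i ^+ 2.

(* f(sigma_i x), computed on a numerator and a denominator of f; it does not
   depend on their choice, as the substitution is injective on polynomials. *)
Definition subst_refl (i : 'I_2) (f : ratfun) : ratfun :=
  mmap cst (refl_var i) (\n_(repr f)) / mmap cst (refl_var i) (\d_(repr f)).

(* The Chinta-Gunnells action of sigma_i, twisted by omega_1. *)
Definition slash_CG (f : ratfun) (i : 'I_2) : ratfun :=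
  if i == ord0
  then (1 - cst u / var ord0) / (1 - cst u * var ord0) * subst_refl i f
  else subst_refl i f.

Definition slash (f : ratfun) (i : 'I_2) : ratfun :=
  - var i ^+ 2 * slash_CG f i.

(* Right action: f | sigma_i1 ... sigma_ik = (f | sigma_i1) | ... | sigma_ik. *)
Definition slash_word (f : ratfun) (s : seq 'I_2) : ratfun := foldl slash f s.

End RationalFunctions.

Section PowerSeries.
Variable R : idomainType.

(* Formal power series in x_0, x_1, given by their coefficients. *)
Definition series := 'X_{1..2} -> R.

Definition series_of (p : {mpoly R[2]}) : series := fun m => p@_m.

(* Cauchy product, written as in the library lemma mcoeffM. *)
Definition series_mul (F G : series) : series := fun m =>
  \sum_(k : 'X_{1..2 < (mdeg m).+1, (mdeg m).+1} | m == (k.1 + k.2)%MM)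
    F k.1 * G k.2.

(* H = F / G, where G is invertible in the ring of power series. *)
Definition is_quotient (F G H : series) : Prop :=
  G 0%MM \is a GRing.unit /\ series_mul G H =1 F.

(* The rational function f is regular at the origin, with power series
   expansion F. *)
Definition is_expansion (f : ratfun R) (F : series) : Prop :=
  exists p q : {mpoly R[2]},
    f = p%:F / q%:F /\ is_quotient (series_of p) (series_of q) F.

(* Unconditional convergence, in the discrete topology of R, of a net indexed
   by the finite subsets of I (represented by duplicate-free sequences). *)
Definition stabilizes (I : eqType) (G : seq I -> R) (c : R) : Prop :=
  exists s0 : seq I, forall s : seq I,
    uniq s -> {subset s0 <= s} -> G s = c.

Definition is_sum (I : eqType) (F : I -> series) (S : series) : Prop :=
  forall m, stabilizes (fun s : seq I => \sum_(i <- s) F i m) (S m).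

Definition is_prod (I : eqType) (F : I -> {mpoly R[2]}) (P : series) : Prop :=
  forall m, stabilizes (fun s : seq I => (\prod_(i <- s) F i)@_m) (P m).

(* P = (a; p)_oo *)
Definition is_qpochhammer (a p : {mpoly R[2]}) (P : series) : Prop :=
  is_prod (fun k : nat => 1 - a * p ^+ k) P.

Definition is_Delta (D : series) : Prop :=
  exists Dre Dim : series,
    [/\ is_prod (fun ik : 'I_2 * nat => 1 - 'X_[real_root ik *+ 2]) Dre,
        is_prod (fun k : nat => 1 - 'X_[delta *+ (2 * k.+1)]) Dim &
        D =1 series_mul Dre Dim].

(* Z = Delta^-1 * \sum_(w in W) 1 | w.  The series T w is the expansion of 1 | w
   computed from any word s representing w, so the independence of 1 | w from
   that word is part of the existence of T. *)
Definition is_Zomega1 (u : R) (Z : series) : Prop :=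
  exists (T : weyl -> series) (S D : series),
    [/\ forall s : seq 'I_2,
          is_expansion (slash_word u 1 s) (T (\pi_weyl s)),
        is_sum T S,
        is_Delta D &
        is_quotient S D Z].

End PowerSeries.

(* Main.v *)
Require Import Defs.
From HB Require Import structures.
From mathcomp Require Import all_boot all_order all_algebra.
From mathcomp Require Import fraction mpoly ring zify.
(* Put q = x_0^2 x_1^2, so that Delta = (x_0^2; q) (q / x_0^2; q) (q; q).
   Following the two reduced words of each length gives 1 | w in closed form, and
   grouping the elements of W in pairs the sum over W becomes the bilateral series
     sum_n t_n (1 - q^(1-2n) / x_0^2),
     t_(n+1) / t_n = q (q^n x_0)^3 (q^n x_0 - u) / (1 - u q^n x_0),
   a limit of Bailey's very-well-poised 6psi6.  It is evaluated through a finite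
   form, in which the n-th term, |n| <= N, is multiplied by
     (q; q)_2N (u x_0; q)_N (u q / x_0; q)_N
       / ((q; q)_(N-n) (q; q)_(N+n) (x_0^2; q)_(N+n) (q / x_0^2; q)_(N-n+1))
   and whose sum is exactly 1 for all N, by telescoping in N.  For n fixed and N
   large this weight times Delta is congruent to (u x_0; q)_N (u q / x_0; q)_N,
   while t_n has large order for |n| large; hence the sum over W, multiplied by
   (u x_0; q) (u q / x_0; q), equals Delta modulo terms of arbitrary degree. *)

Set Implicit Arguments.
Unset Strict Implicit.
Unset Printing Implicit Defensive.
Import GRing.Theory.
Local Open Scope ring_scope.
Local Open Scope quotient_scope.

(** * The algebraic identity behind the Wilf-Zeilberger pair *)

Section WZAlgebra.
Variable K : fieldType.

(* wz_step divided by the common factor of its four terms, with S = q ^ r,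
   T = z q ^ r and a = x q ^ n. *)
Lemma wz_identity (q u a S T : K) :
  (q * a ^+ 2 - 1) *
    ((1 - q ^+ 2 * S * a ^+ 2 * T) * (1 - q ^+ 3 * S * a ^+ 2 * T)
       * (1 - u * a * q * S) * (1 - u * q * a * T)
     - (1 - q * S) * (1 - q ^+ 2 * a ^+ 2 * T) * (1 - q ^+ 2 * a ^+ 2 * S) * (1 - q * T))
  = q ^+ 2 * a ^+ 3 * (q * a - u) * (1 - q * S) * (1 - q * T)
    * (S * (1 - q ^+ 2 * a ^+ 2 * T) * (1 - T)
       + T * (1 - q ^+ 2 * S * a ^+ 2 * T) * (1 - u * a * q * S))
  - q * (1 - u * a) * (1 - q ^+ 2 * a ^+ 2 * T) * (1 - q ^+ 2 * a ^+ 2 * S)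
    * (S * (1 - q * a ^+ 2 * T) * (1 - q * T)
       + T * (1 - q ^+ 2 * S * a ^+ 2 * T) * (1 - u * a * q * S)).
Proof. ring. Qed.

(** Clears the q-Pochhammer symbols common to the four terms of [wz_step]. There [t] is [tterm x n],
    the [c]s and [P]s are such symbols, and [E1], [E2], [L], [M], [A], [B2], [B3], [G3], [Z0], [Z1]
    are factors gained when an index grows; all stay opaque for [field]. *)
Lemma wz_cancel (t q u a b c1 c2 c3 y D E1 E2 L M A B2 B3 G3 Z0 Z1 : K)
    (P1 P3 P4 P7 k k1 N : K) :
  a != 0 -> b != 0 -> q != 0 -> k != 0 -> k1 != 0 -> D != 0 ->
  A != 0 -> B2 != 0 -> B3 != 0 -> G3 != 0 -> Z0 != 0 -> Z1 != 0 ->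
  P1 != 0 -> P3 != 0 -> P4 != 0 -> P7 != 0 ->
  a ^+ 2 * y * (E1 * E2 * L * M - A * B3 * G3 * Z1) =
    a ^+ 2 * q * b * (b - u) * N * A * Z1 * (B3 * Z0 / (q * k1) + E1 * L * k1 / b ^+ 2)
    - D * N * B3 * G3 * (B2 * Z1 / (q * k) + E1 * L * k / a ^+ 2) ->
  t * (q * a ^+ 3 * (a - u) / D) * y * (c1 * E1 * E2 * (c2 * L * (c3 * M)))
    / (P3 * A * (P1 * B2 * B3) * (P4 * G3 * (P7 * Z0 * Z1)))
  - t * (q * a ^+ 3 * (a - u) / D) * y * (c1 * (c2 * c3))
    / (P3 * (P1 * B2) * (P4 * (P7 * Z0)))
  = t * (q * a ^+ 3 * (a - u) / D) * q * b * (b - u) * (c1 * (c2 * c3)) * N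
      / (P3 * (P1 * B2) * (P4 * G3 * P7))
      * ((q * k1)^-1 + E1 * L * k1 / (b ^+ 2 * B3 * Z0))
    - t * q * a * (a - u) * (c1 * (c2 * c3)) * N / (P3 * A * P1 * (P4 * (P7 * Z0)))
      * ((q * k)^-1 + E1 * L * k / (a ^+ 2 * B2 * Z1)).
Proof.
move=> a0 b0 q0 k0 k10 Delta_series A0 B20 B30 G30 Z00 Z10 P10 P30 P40 P70 core.
set p := t * q * a * (a - u) * (c1 * (c2 * c3))
  / (D * (P3 * A) * (P1 * B2 * B3) * (P4 * G3) * (P7 * Z0 * Z1)).
transitivity (p * (a ^+ 2 * y * (E1 * E2 * L * M - A * B3 * G3 * Z1))).
  rewrite /p; field.
  by rewrite Delta_series A0 B20 B30 G30 Z00 Z10 P10 P30 P40 P70.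
rewrite core /p; field.
by rewrite a0 b0 q0 k0 k10 Delta_series A0 B20 B30 G30 Z00 Z10 P10 P30 P40 P70.
Qed.

Section Core.
Variables (q x z u k S : K).
Hypotheses (qE : q = x ^+ 2 * z) (x0 : x != 0) (z0 : z != 0) (k0 : k != 0).

Let wz_core_lhs V : q * ((x * k) ^+ 2 * (1 - z / (q * k) ^+ 2) * V) =
  (q * (x * k) ^+ 2 - 1) * V.
Proof. by rewrite qE; field; rewrite x0 z0 k0. Qed.

Let wz_core_rhs W D A B2 B3 G3 Z0 Z1 :
  q * ((x * k) ^+ 2 * q * (x * (q * k)) * (x * (q * k) - u) * (q * (S * k)) * A * Z1
         * (B3 * Z0 / (q * (q * k)) + W * (q * k) / (x * (q * k)) ^+ 2)
       - D * (q * (S * k)) * B3 * G3 * (B2 * Z1 / (q * k) + W * k / (x * k) ^+ 2))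
  = q ^+ 2 * (x * k) ^+ 3 * (q * (x * k) - u) * A * Z1 * (S * B3 * Z0 + z * S * W)
    - q * D * B3 * G3 * (S * B2 * Z1 + z * S * W).
Proof. by rewrite qE; field; rewrite x0 z0 k0. Qed.

(** The last premise of [wz_cancel] with its factors written out, for [S] = q ^ r and [k] = q ^ n.
    Multiplied by q, and with x ^ 2 z = q clearing the denominators, it is [wz_identity] at a = x k,
    T = z S. *)
Lemma wz_core :
  (x * k) ^+ 2 * (1 - z / (q * k) ^+ 2) *
    ((1 - q * (q * (q * (S * k * (S * k))))) * (1 - q * (q * (q * (q * (S * k * (S * k))))))
       * (1 - u * (x * (q * (S * k)))) * (1 - u * (x * z) * (q * (S * k)))
     - (1 - q * S) * (1 - q * (q * (q * (S * k * k))))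
       * (1 - x ^+ 2 * (q * (q * (S * k * k)))) * (1 - z * (q * S))) =
  (x * k) ^+ 2 * q * (x * (q * k)) * (x * (q * k) - u) * (q * (S * k))
    * (1 - q * S) * (1 - z * (q * S)) *
    ((1 - q * (q * (q * (S * k * k)))) * (1 - z * S) / (q * (q * k)) +
     (1 - q * (q * (q * (S * k * (S * k))))) * (1 - u * (x * (q * (S * k)))) * (q * k)
       / (x * (q * k)) ^+ 2)
  - (1 - u * (x * k)) * (q * (S * k)) * (1 - q * (q * (q * (S * k * k))))
    * (1 - x ^+ 2 * (q * (q * (S * k * k)))) *
    ((1 - q * (q * (S * k * k))) * (1 - z * (q * S)) / (q * k) +
     (1 - q * (q * (q * (S * k * (S * k))))) * (1 - u * (x * (q * (S * k)))) * k
       / (x * k) ^+ 2).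
Proof.
have q0 : q != 0 by rewrite qE mulf_neq0 ?expf_neq0.
apply: (mulfI q0); rewrite wz_core_lhs wz_core_rhs.
have -> : q * (q * (q * (q * (S * k * (S * k))))) = q ^+ 3 * S * (x * k) ^+ 2 * (z * S).
  by rewrite qE; ring.
have -> : q * (q * (q * (S * k * (S * k)))) = q ^+ 2 * S * (x * k) ^+ 2 * (z * S).
  by rewrite qE; ring.
have -> : u * (x * (q * (S * k))) = u * (x * k) * q * S by ring.
have -> : u * (x * z) * (q * (S * k)) = u * q * (x * k) * (z * S) by ring.
have -> : q * (q * (q * (S * k * k))) = q ^+ 2 * (x * k) ^+ 2 * (z * S).
  by rewrite qE; ring.
have -> : x ^+ 2 * (q * (q * (S * k * k))) = q ^+ 2 * (x * k) ^+ 2 * S by ring.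
have -> : q * (q * (S * k * k)) = q * (x * k) ^+ 2 * (z * S) by rewrite qE; ring.
have -> : z * (q * S) = q * (z * S) by ring.
by rewrite wz_identity !mulrA.
Qed.

End Core.

End WZAlgebra.

(** * The finite bilateral sum and its telescoping in N *)

Section FiniteIdentity.
Variable K : fieldType.
Variables q u : K.

Definition qpoch (a : K) n := \prod_(i < n) (1 - a * q ^+ i).

Lemma qpoch0 a : qpoch a 0 = 1. Proof. exact: big_ord0. Qed.

Lemma qpochS a n : qpoch a n.+1 = qpoch a n * (1 - a * q ^+ n).
Proof. exact: big_ord_recr. Qed.

Lemma qpoch_neq0 a n : (forall k, 1 - a * q ^+ k != 0) -> qpoch a n != 0.
Proof. by move=> h; apply/prodf_neq0 => i _. Qed.

Definition tterm x n :=
  \prod_(k < n) (q * (x * q ^+ k) ^+ 3 * (x * q ^+ k - u) / (1 - u * (x * q ^+ k))).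

Lemma ttermS x n : tterm x n.+1 =
  tterm x n * (q * (x * q ^+ n) ^+ 3 * (x * q ^+ n - u) / (1 - u * (x * q ^+ n))).
Proof. exact: big_ord_recr. Qed.

Definition numC x z N := qpoch q (N + N) * (qpoch (u * x) N * qpoch (u * (x * z)) N).

(* Summand of index n of the identity of order N = r + n; z stands for q / x ^ 2,
   that is for x_1 ^ 2.  Together with wzH it is a Wilf-Zeilberger pair: the
   change of wzF from N to N + 1 is the difference in n of wzH. *)
Definition wzF x z r n :=
  tterm x n * (1 - z / q ^+ n ^+ 2) * numC x z (r + n) /
  (qpoch q r * qpoch q (r + n + n) * (qpoch (x ^+ 2) (r + n + n)
   * qpoch z r.+1)).

Definition wzH x z r m :=
  tterm x m * q * (x * q ^+ m) * (x * q ^+ m - u) * numC x z (r + m) * q ^+ (r + m)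
  / (qpoch q r * qpoch q (r + m + m) * (qpoch (x ^+ 2) (r + m + m).+1
     * qpoch z r))
  * ((q * q ^+ m)^-1 + (1 - q ^+ (r + m + (r + m)).+1) * (1 - u * (x * q ^+ (r + m))) * q ^+ m
      / ((x * q ^+ m) ^+ 2 * (1 - q ^+ (r + m + m).+1) * (1 - z * q ^+ r))).

Definition wzU x z N := \sum_(n < N) wzF x z (N - n.+1) n.+1.

Section WZ.
Variables x z : K.
Hypothesis qE : q = x ^+ 2 * z.
Hypothesis z0 : z != 0.
Hypothesis x0 : x != 0.
Hypothesis nzq : forall n, 1 - q * q ^+ n != 0.
Hypothesis nzx2 : forall n, 1 - x ^+ 2 * q ^+ n != 0.
Hypothesis nzy2 : forall n, 1 - z * q ^+ n != 0.
Hypothesis nza : forall n, 1 - u * (x * q ^+ n) != 0.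

Let q0 : q != 0. Proof. by rewrite qE mulf_neq0 ?expf_neq0. Qed.

(** This is [wz_step] at r = -1, where 1 / (q; q)_r vanishes: the summand of index N + 1 has no
    counterpart of order N. *)
Lemma wz_base n : wzF x z 0 n.+1 = - wzH x z 0 n.
Proof.
have h1 := qpoch_neq0 (n + n) nzq; have h2 := qpoch_neq0 (n + n) nzx2.
have := (nzq (n + n), nzq (n + n).+1, nzx2 (n + n), nzx2 (n + n).+1, nzy2 0, nza n).
rewrite /wzF /wzH !add0n ttermS /numC !addnS !addSn !qpochS !qpoch0.
have qn0 : q ^+ n != 0 by rewrite expf_neq0.
rewrite !exprS !exprD expr0 !mulr1.
move: (qpoch q _) (qpoch (x ^+ 2) _) (qpoch (u * x) _) (qpoch (u * (x * z)) _) h1 h2.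
move: (tterm x n) (q ^+ n) qn0 => t Q Q0 P1 P2 P3 P4 h1 h2.
rewrite qE => -[] [] [] [] [] h3 h4 h5 h6 h7 h8.
field.
by rewrite h1 h2 h3 h4 h5 h6 h7 h8 z0 x0 Q0.
Qed.

(** Both values of [wzH] have order r + n + 1 and their indices are consecutive, so for a fixed
    order the right-hand side telescopes. *)
Lemma wz_step r n :
  wzF x z r.+1 n.+1 - wzF x z r n.+1 = wzH x z r n.+1 - wzH x z r.+1 n.
Proof.
rewrite /wzF /wzH ttermS /numC !(addnS, addSn) !qpochS !(exprS q).
rewrite -![u * x * (q * _)]mulrA.
have qX0 m : q ^+ m != 0 by rewrite expf_neq0.
have nzqX m : 1 - q ^+ m.+1 != 0 by rewrite exprS.
apply: wz_cancel; rewrite -?exprS ?mulf_neq0 ?qpoch_neq0 //.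
by rewrite !(exprS q) !exprD; apply: wz_core.
Qed.

(** The telescoping sum leaves [wzH] at indices N and 0; the value at N cancels against the new
    summand by [wz_base]. *)
Lemma wzUS N : wzU x z N.+1 - wzU x z N = - wzH x z N 0.
Proof.
rewrite /wzU big_ord_recr /= subnn wz_base addrAC -sumrB.
rewrite -(big_mkord xpredT (fun i => wzF x z (N.+1 - i.+1) i.+1 - wzF x z (N - i.+1) i.+1)).
rewrite (telescope_sumr_eq (fun i => wzH x z (N - i) i)) //.
  by rewrite subnn subn0; ring.
by move=> i /= ltiN; rewrite subSS -(subnSK ltiN) wz_step.
Qed.

End WZ.

Lemma qpochSl a n : qpoch a n.+1 = (1 - a) * qpoch (a * q) n.
Proof.
rewrite /qpoch big_ord_recl expr0 mulr1; congr (_ * _).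
by apply: eq_bigr => i _; rewrite -mulrA -exprS.
Qed.

Section Bilateral.
Variables x z : K.
Hypothesis qE : q = x ^+ 2 * z.
Hypothesis z0 : z != 0.
Hypothesis x0 : x != 0.
Hypothesis nzq : forall n, 1 - q * q ^+ n != 0.
Hypothesis nzx2 : forall n, 1 - x ^+ 2 * q ^+ n != 0.
Hypothesis nzy2 : forall n, 1 - z * q ^+ n != 0.
Hypothesis nza : forall n, 1 - u * (x * q ^+ n) != 0.
Hypothesis nzb : forall n, 1 - u * (x * z * q ^+ n) != 0.

Let q0 : q != 0. Proof. by rewrite qE mulf_neq0 ?expf_neq0. Qed.

(** The pair (x z, z^-1) meets the same hypotheses as (x, z): since (x z) ^ 2 = z q and z^-1 q = x ^
    2, its factors are those of (x, z) shifted by one, apart from 1 - z^-1. *)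
Let xz_qE : q = (x * z) ^+ 2 * z^-1.
Proof. by rewrite qE; field. Qed.

Let nz_xz2 n : 1 - (x * z) ^+ 2 * q ^+ n != 0.
Proof.
suff -> : (x * z) ^+ 2 * q ^+ n = z * q ^+ n.+1 by [].
by rewrite (exprS q) {2}qE; ring.
Qed.

Let nz_zV n : 1 - z^-1 * q ^+ n != 0.
Proof.
case: n => [|n].
  rewrite expr0 mulr1; have := nzy2 0; rewrite expr0 mulr1.
  by apply: contraNneq => /subr0_eq/(congr1 GRing.inv); rewrite invr1 invrK => <-; rewrite subrr.
suff -> : z^-1 * q ^+ n.+1 = x ^+ 2 * q ^+ n by [].
by rewrite (exprS q) {1}qE; field.
Qed.

(** The central term gains what the two halves lose: by [wzUS] each half changes by minus its [wzH]
    at index 0, hence the full sum does not depend on N. *)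
Lemma wz_center N :
  wzF x z N.+1 0 - wzF x z N 0 = wzH x z N 0 + wzH (x * z) z^-1 N 0.
Proof.
have h1 := qpoch_neq0 N nzq; have h2 := qpoch_neq0 N nzx2.
have h3 := qpoch_neq0 N nzy2.
(* [E1] and [E2] express the symbols of the exchanged pair through those of z and x ^ 2, so that
   [field] sees a single set of symbols. *)
have E1 : qpoch ((x * z) ^+ 2) N.+1 = qpoch z N.+2 / (1 - z).
  have nz1 : 1 - z != 0 by have := nzy2 0; rewrite expr0 mulr1.
  have -> : (x * z) ^+ 2 = z * q by rewrite qE; ring.
  by rewrite [qpoch z _]qpochSl mulrAC divff ?mul1r.
have E2 : qpoch z^-1 N = (1 - z^-1) * qpoch (x ^+ 2) N / (1 - z^-1 * q ^+ N).
  have -> : x ^+ 2 = z^-1 * q by rewrite qE; field.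
  by rewrite -qpochSl qpochS mulfK ?nz_zV.
rewrite /wzF /wzH !addn0 E1 E2 /numC !(addnS, addSn) !qpochS /tterm !big_ord0.
have -> : x * z * z^-1 = x by rewrite mulfK.
have := (nzq N, nzx2 N, nzy2 N, nzy2 N.+1, nz_zV 0, nz_zV N, nzy2 0).
have qN0 : q ^+ N != 0 by rewrite expf_neq0.
rewrite !exprS !exprD expr0 !mulr1.
move: (qpoch q (N + N)) (qpoch q N) (qpoch (x ^+ 2) _) (qpoch (u * x) _)
  (qpoch (u * (x * z)) _) (qpoch z N) h1 h2 h3.
move: (q ^+ N) qN0 => Q Q0 P1 P2 P3 P4 P5 P6 h1 h2 h3.
rewrite qE => -[] [] [] [] [] [] h4 h5 h6 h7 h8 h9 h10.
have h11 : z - Q != 0.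
  by apply: contraNneq h9 => /subr0_eq <-; rewrite mulVf ?subrr.
have h12 : z - 1 != 0 by rewrite -opprB oppr_eq0.
field.
by rewrite oner_neq0 h1 h2 h3 h4 h5 h6 h7 h10 h11 h12 z0 x0.
Qed.

(** The exchange swaps the roles of x ^ 2 and z in the denominator, with lengths shifted by one; the
    factor - z is (1 - z) / (1 - z^-1). *)
Lemma wzF_refl r n : wzF (x * z) z^-1 r n =
  - z * tterm (x * z) n * (1 - z^-1 / q ^+ n ^+ 2) * numC x z (r + n) /
  (qpoch q r * qpoch q (r + n + n) * (qpoch (x ^+ 2) r * qpoch z (r + n + n).+1)).
Proof.
rewrite /wzF /numC mulfK // [qpoch (u * x) _ * _]mulrC.
have nz1 : 1 - z != 0 by have := nzy2 0; rewrite expr0 mulr1.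
have h1 := qpoch_neq0 r nzq; have h2 := qpoch_neq0 r nzx2.
have h3 := qpoch_neq0 (r + n + n) nzq; have h4 := qpoch_neq0 (r + n + n).+1 nzy2.
have -> : qpoch ((x * z) ^+ 2) (r + n + n) = qpoch z (r + n + n).+1 / (1 - z).
  have -> : (x * z) ^+ 2 = z * q by rewrite qE; ring.
  by rewrite [qpoch z _]qpochSl mulrAC divff ?mul1r.
have -> : qpoch z^-1 r.+1 = (1 - z^-1) * qpoch (x ^+ 2) r.
  have -> : x ^+ 2 = z^-1 * q by rewrite qE; field.
  exact: qpochSl.
have qn0 : q ^+ n != 0 by rewrite expf_neq0.
move: (qpoch q r) (qpoch q (r + n + n)) (qpoch (x ^+ 2) r) (qpoch z _) h1 h2 h3 h4.
move: (q ^+ n) qn0 => Q Q0 P1 P2 P3 P4 h1 h2 h3 h4.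
have h5 : z - 1 != 0 by rewrite -opprB oppr_eq0.
by field; rewrite Q0 h1 h2 h3 h4 h5 nz1 z0.
Qed.

(* Finite form of the sum 6psi6 with three parameters sent to infinity; the terms
   of negative index are those of positive index after the exchange of x_0 and
   q / x_0, i.e. of (x, z) and (x * z, z^-1). *)
Lemma wz_bilateral N : wzF x z N 0 + wzU x z N + wzU (x * z) z^-1 N = 1.
Proof.
elim: N => [|N <-].
  rewrite /wzU !big_ord0 !addr0 /wzF /tterm /numC !qpochS !qpoch0 !big_ord0.
  have := nzy2 0; rewrite expr0 expr1n !divr1 !mulr1 !mul1r => h.
  by rewrite divff.
have H1 := wzUS qE z0 x0 nzq nzx2 nzy2 nza N.
have H2 : wzU (x * z) z^-1 N.+1 - wzU (x * z) z^-1 N = - wzH (x * z) z^-1 N 0.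
  by apply: (wzUS _ _ _ nzq _ _ nzb);
    rewrite ?invr_eq0 ?mulf_neq0 -?xz_qE.
have H3 := wz_center N.
apply/subr0_eq; rewrite !opprD addrACA [_ + _ + (- _ - _)]addrACA H1 H2 H3.
by ring.
Qed.
End Bilateral.

End FiniteIdentity.

(** * Filtered fields and congruences between q-Pochhammer symbols *)

(* Model: sm d f when f is regular at the origin and vanishes there to order d. *)
Record filtration (K : fieldType) (sm : nat -> K -> Prop) : Prop := Filtration {
  fil0 : forall d, sm d 0;
  fil1 : sm 0 1;
  filB : forall d f g, sm d f -> sm d g -> sm d (f - g);
  filM : forall d e f g, sm d f -> sm e g -> sm (d + e) (f * g);
  fil_le : forall e d f, (e <= d)%N -> sm d f -> sm e f;
  filV : forall f, sm 1 f -> 1 - f != 0 /\ sm 0 (1 - f)^-1 }.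

Section Filtration.
Variables (K : fieldType) (sm : nat -> K -> Prop).
Hypothesis fil : filtration sm.
Implicit Types f g : K.

Lemma filN d f : sm d f -> sm d (- f).
Proof. by move=> hf; rewrite -sub0r; apply: (filB fil) => //; apply: fil0 fil _. Qed.

Lemma filD d f g : sm d f -> sm d g -> sm d (f + g).
Proof. by move=> hf hg; rewrite -[g]opprK; apply: (filB fil) => //; apply: filN. Qed.

Lemma fil_ge0 d f : sm d f -> sm 0 f.
Proof. exact: (fil_le fil). Qed.

Lemma filMl d f g : sm 0 f -> sm d g -> sm d (f * g).
Proof. exact: (filM fil). Qed.

Lemma filMr d f g : sm d f -> sm 0 g -> sm d (f * g).
Proof. by move=> hf hg; rewrite mulrC; apply: filMl. Qed.

Lemma fil_sum d (I : Type) (s : seq I) (P : pred I) (f : I -> K) :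
  (forall i, P i -> sm d (f i)) -> sm d (\sum_(i <- s | P i) f i).
Proof. by move=> hf; elim/big_ind: _ => //; [exact: fil0 fil _|apply: filD]. Qed.

Lemma filX0 f n : sm 0 f -> sm 0 (f ^+ n).
Proof.
move=> hf; elim: n => [|n IHn]; first exact: (fil1 fil).
by rewrite exprS; apply: filMl.
Qed.

Lemma filX f n : sm 1 f -> sm n (f ^+ n).
Proof.
move=> hf; elim: n => [|n IHn]; first exact: (fil1 fil).
by rewrite exprS; apply: (@filM _ _ fil 1).
Qed.

Lemma fil_inv_congr d f g : sm 0 f^-1 -> sm 0 g^-1 -> f != 0 -> g != 0 ->
  sm d (f - g) -> sm d (f^-1 - g^-1).
Proof.
move=> hf hg f0 g0 hfg; have -> : f^-1 - g^-1 = - (f - g) * (f^-1 * g^-1).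
  by field; rewrite f0 g0.
by apply: filMr; [apply: filN|apply: filMl].
Qed.

Lemma fil_mul_congr d f f' g g' : sm 0 f -> sm 0 g' ->
  sm d (f - f') -> sm d (g - g') -> sm d (f * g - f' * g').
Proof.
move=> hf hg' hff' hgg'.
have -> : f * g - f' * g' = f * (g - g') + (f - f') * g' by ring.
by apply: filD; [apply: filMl|apply: filMr].
Qed.

Section QPochhammer.
Variable q : K.
Hypothesis q1 : sm 1 q.

Lemma fil_mul_qX a n : sm 1 a -> sm n.+1 (a * q ^+ n).
Proof. by move=> ha; apply: (filM fil ha); apply: filX. Qed.

Lemma fil1_mul_qX a n : sm 1 a -> sm 1 (a * q ^+ n).
Proof. by move=> ha; apply: (fil_le fil) (fil_mul_qX n ha). Qed.

Lemma qpoch_factor_neq0 a n : sm 1 a -> 1 - a * q ^+ n != 0.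
Proof. by move=> /(fil1_mul_qX n) /(filV fil)[]. Qed.

Lemma fil0_qpoch a n : sm 1 a -> sm 0 (qpoch q a n).
Proof.
move=> ha; elim: n => [|n IHn]; first by rewrite qpoch0; apply: fil1 fil.
rewrite qpochS; apply: filMl => //; apply: (filB fil); first exact: fil1 fil.
exact/fil_ge0/(fil_mul_qX n ha).
Qed.

Lemma fil0_qpochV a n : sm 1 a -> sm 0 (qpoch q a n)^-1.
Proof.
move=> ha; elim: n => [|n IHn]; first by rewrite qpoch0 invr1; apply: fil1 fil.
rewrite qpochS invfM; apply: filMl => //.
by case: (filV fil (fil1_mul_qX n ha)).
Qed.

(** Every factor of index k >= d is 1 modulo order d, so all symbols of length at least d are
    congruent; this stands in for convergence to the infinite product. *)
Lemma qpoch_congr a d i j : sm 1 a -> (d <= i)%N -> (d <= j)%N ->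
  sm d (qpoch q a i - qpoch q a j).
Proof.
move=> ha; suff h k : (d <= k)%N -> sm d (qpoch q a k - qpoch q a d).
  move=> /h hi /h hj.
  rewrite (_ : _ - _ = (qpoch q a i - qpoch q a d) - (qpoch q a j - qpoch q a d)); last by ring.
  exact: (filB fil).
elim: k => [|k IHk]; first by rewrite leqn0 => /eqP ->; rewrite subrr; apply: fil0 fil _.
rewrite leq_eqVlt => /orP[/eqP ->|]; first by rewrite subrr; apply: fil0 fil _.
rewrite ltnS => le_dk; rewrite qpochS mulrBr mulr1 addrAC.
apply: (filB fil); first exact: IHk.
apply: filMl; first exact: fil0_qpoch.
by apply: (fil_le fil) (fil_mul_qX k ha); apply: leqW.
Qed.

Lemma qpochV_congr a d i j : sm 1 a -> (d <= i)%N -> (d <= j)%N ->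
  sm d ((qpoch q a i)^-1 - (qpoch q a j)^-1).
Proof.
move=> ha di dj; apply: fil_inv_congr; rewrite ?qpoch_neq0 //; last exact: qpoch_congr.
- exact: fil0_qpochV.
- exact: fil0_qpochV.
- by move=> k; apply: qpoch_factor_neq0.
by move=> k; apply: qpoch_factor_neq0.
Qed.

End QPochhammer.
End Filtration.

(** * Closed form of the orbit of 1 under the Weyl group *)

Section Orbit.
Variables (K : fieldType) (x y u : K).
Definition xdelta2 : K := (x * y) ^+ 2.
Local Notation q := xdelta2.

Definition xa h : K := x * q ^+ h.
Definition xb h : K := x * y ^+ 2 * q ^+ h.

(** The factor attached to the root beta = alpha_0 + m delta (alpha_1 + m delta for [rneg]): minus
    the square of x^beta, multiplied by (1 - u / x^beta) / (1 - u x^beta) if beta lies in the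
    W-orbit of alpha_0. *)
Definition rpos m : K :=
  if odd m then - x ^+ 2 * q ^+ m
  else - xa m./2 * (xa m./2 - u) / (1 - u * xa m./2).

Definition rneg m : K :=
  if odd m then - xb m./2 * (xb m./2 - u) / (1 - u * xb m./2)
  else - y ^+ 2 * q ^+ m.

(* Epos m (Eneg m) is 1 | w, for the w of length m whose reduced word ends with
   sigma_0 (sigma_1); xa h and xb h are the monomials of the real roots
   alpha_0 + 2h delta and alpha_1 + (2h + 1) delta. *)
Definition Epos m : K := \prod_(k < m) rpos k.
Definition Eneg m : K := \prod_(k < m) rneg k.

Lemma EposS m : Epos m.+1 = Epos m * rpos m. Proof. exact: big_ord_recr. Qed.
Lemma EnegS m : Eneg m.+1 = Eneg m * rneg m. Proof. exact: big_ord_recr. Qed.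
Lemma Epos0 : Epos 0 = 1. Proof. exact: big_ord0. Qed.
Lemma Eneg0 : Eneg 0 = 1. Proof. exact: big_ord0. Qed.

Hypotheses (x0 : x != 0) (y0 : y != 0).

Lemma xdelta2_neq0 : q != 0.
Proof. by rewrite expf_neq0 ?mulf_neq0. Qed.

Section Reflections.
Variables s0 s1 : {rmorphism K -> K}.
Hypotheses (s0u : s0 u = u) (s1u : s1 u = u).
Hypotheses (s0x : s0 x = x^-1) (s0y : s0 y = y * x ^+ 2).
Hypotheses (s1x : s1 x = x * y ^+ 2) (s1y : s1 y = y^-1).

Lemma s0q : s0 q = q.
Proof. by rewrite rmorphXn rmorphM /= s0x s0y /xdelta2; field. Qed.

Lemma s1q : s1 q = q.
Proof. by rewrite rmorphXn rmorphM /= s1x s1y /xdelta2; field. Qed.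

Lemma s1_xa h : s1 (xa h) = xb h.
Proof. by rewrite rmorphM rmorphXn /= s1q s1x. Qed.

Lemma s1_xb h : s1 (xb h) = xa h.
Proof. by rewrite rmorphM rmorphXn s1q rmorphM rmorphXn /= s1x s1y /xa; field. Qed.

Lemma s0_xb h : s0 (xb h) = xa h.+1.
Proof.
rewrite rmorphM rmorphXn s0q rmorphM rmorphXn /= s0x s0y /xa (exprS q).
by move: (q ^+ h) => Q; rewrite /xdelta2; field.
Qed.

Lemma s0_xa h : s0 (xa h.+1) = xb h.
Proof.
rewrite rmorphM rmorphXn /= s0q s0x /xb (exprS q).
by move: (q ^+ h) => Q; rewrite /xdelta2; field.
Qed.

Lemma rmorph_ratio (s : {rmorphism K -> K}) a : s u = u ->
  s (- a * (a - u) / (1 - u * a)) = - s a * (s a - u) / (1 - u * s a).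
Proof. by move=> su; rewrite fmorph_div !rmorphM !rmorphB rmorphN rmorph1 rmorphM /= su. Qed.

(** sigma_1 sends alpha_0 + m delta to alpha_1 + (m + 1) delta, in the same W-orbit; the next three
    lemmas hold likewise. *)
Lemma s1_rpos m : s1 (rpos m) = rneg m.+1.
Proof.
rewrite /rpos /rneg /= uphalf_half; case: ifP => om /=; last first.
  by rewrite rmorph_ratio // s1_xa.
rewrite rmorphM [s1 (q ^+ _)]rmorphXn s1q rmorphN rmorphXn /= s1x (exprS q).
by move: (q ^+ m) => Q; rewrite /xdelta2; ring.
Qed.

Lemma s1_rneg m : s1 (rneg m.+1) = rpos m.
Proof.
rewrite /rpos /rneg /= uphalf_half; case: (boolP (odd m)) => om /=.
  rewrite rmorphM [s1 (q ^+ _)]rmorphXn s1q rmorphN rmorphXn /= s1y (exprS q).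
  by move: (q ^+ m) => Q; rewrite /xdelta2; field.
by rewrite rmorph_ratio // s1_xb.
Qed.

Lemma s0_rneg m : s0 (rneg m) = rpos m.+1.
Proof.
rewrite /rpos /rneg /= uphalf_half; case: ifP => om /=.
  by rewrite rmorph_ratio // s0_xb.
rewrite rmorphM [s0 (q ^+ _)]rmorphXn s0q rmorphN rmorphXn /= s0y (exprS q).
by move: (q ^+ m) => Q; rewrite /xdelta2; ring.
Qed.

Lemma s0_rpos m : s0 (rpos m.+1) = rneg m.
Proof.
rewrite /rpos /rneg /= uphalf_half; case: (boolP (odd m)) => om /=.
  by rewrite rmorph_ratio // s0_xa.
rewrite rmorphM [s0 (q ^+ _)]rmorphXn s0q rmorphN rmorphXn /= s0x (exprS q).
by move: (q ^+ m) => Q; rewrite /xdelta2; field.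
Qed.

(** sigma_1 moves every factor one place up, and the prefactor - y ^ 2 of the action is the missing
    first factor [rneg 0]. *)
Lemma s1_Epos m : - y ^+ 2 * s1 (Epos m) = Eneg m.+1.
Proof.
rewrite rmorph_prod /Eneg big_ord_recl /=; congr (_ * _).
  by rewrite /rneg /= mulr1.
by apply: eq_bigr => i _; apply: s1_rpos.
Qed.

Lemma s1_Eneg m : - y ^+ 2 * s1 (Eneg m.+1) = Epos m.
Proof.
rewrite /Eneg big_ord_recl rmorphM rmorph_prod /= mulrA.
rewrite /rneg /= mulr1 rmorphN rmorphXn /= s1y mulrNN -exprMn divff // expr1n mul1r.
by apply: eq_bigr => i _; apply: s1_rneg.
Qed.

Hypotheses (nzux : 1 - u * x != 0) (nzxu : x - u != 0).

Lemma s0_Eneg m :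
  - x ^+ 2 * ((1 - u / x) / (1 - u * x) * s0 (Eneg m)) = Epos m.+1.
Proof.
rewrite rmorph_prod /Epos big_ord_recl /= !mulrA; congr (_ * _).
  by rewrite /rpos /= /xa expr0 mulr1; field; rewrite x0 nzux.
by apply: eq_bigr => i _; apply: s0_rneg.
Qed.

Lemma s0_Epos m :
  - x ^+ 2 * ((1 - u / x) / (1 - u * x) * s0 (Epos m.+1)) = Eneg m.
Proof.
rewrite /Epos big_ord_recl rmorphM rmorph_prod /= !mulrA.
(* The prefactor and the image of [rpos 0] multiply to 1, because x, x - u and 1 - u x are
   nonzero. *)
rewrite [X in X * \prod_(_ < _) _](_ : _ = 1) ?mul1r.
  by apply: eq_bigr => i _; apply: s0_rpos.
rewrite /rpos /= /xa expr0 mulr1 rmorph_ratio // s0x.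
by field; rewrite x0 nzux nzxu.
Qed.

End Reflections.

(** * Order of vanishing of the terms and passage to the limit *)

Section Smallness.
Variable sm : nat -> K -> Prop.
Hypothesis fil : filtration sm.
Hypotheses (smx : sm 1 x) (smy : sm 1 y) (smu : sm 0 u).

Lemma fil_xdelta2 : sm 1 q.
Proof.
apply: (@fil_le _ _ fil _ 2) => //; apply: (filX fil).
exact/(filMr fil smx)/(fil_ge0 fil smy).
Qed.

Lemma fil_sqr v : sm 1 v -> sm 1 (v ^+ 2).
Proof. by move=> /(filX fil 2); apply: (fil_le fil). Qed.

Lemma fil_xa h : sm 1 (xa h).
Proof. exact: (fil1_mul_qX fil fil_xdelta2). Qed.

Lemma fil_xy2 : sm 1 (x * y ^+ 2).
Proof. exact/(filMr fil smx)/(filX0 fil)/(fil_ge0 fil smy). Qed.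

Lemma fil_xb h : sm 1 (xb h).
Proof. exact/(fil1_mul_qX fil fil_xdelta2)/fil_xy2. Qed.

Lemma fil_ratio a : sm 1 a -> sm 1 (- a * (a - u) / (1 - u * a)).
Proof.
move=> ha; have [_ hV] := filV fil (filMl fil smu ha).
apply/(filMr fil)/hV/(filMr fil); first exact: (filN fil).
exact/(filB fil)/smu/(fil_ge0 fil ha).
Qed.

Lemma fil_sqr_qX v n : sm 1 v -> sm 1 (- v ^+ 2 * q ^+ n).
Proof.
move=> /fil_sqr hv; apply: (fil1_mul_qX fil fil_xdelta2); exact: (filN fil).
Qed.

Lemma fil_rpos m : sm 1 (rpos m).
Proof. by rewrite /rpos; case: ifP => _; [apply: fil_sqr_qX|apply/fil_ratio/fil_xa]. Qed.

Lemma fil_rneg m : sm 1 (rneg m).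
Proof. by rewrite /rneg; case: ifP => _; [apply/fil_ratio/fil_xb|apply: fil_sqr_qX]. Qed.

(** Each of the m factors vanishes at the origin. This makes the sum over W converge and the far
    terms negligible. *)
Lemma fil_Epos m : sm m (Epos m).
Proof.
elim: m => [|m IHm]; first by rewrite Epos0; apply: fil1 fil.
by rewrite EposS -addn1; apply: (filM fil) => //; apply: fil_rpos.
Qed.

Lemma fil_Eneg m : sm m (Eneg m).
Proof.
elim: m => [|m IHm]; first by rewrite Eneg0; apply: fil1 fil.
by rewrite EnegS -addn1; apply: (filM fil) => //; apply: fil_rneg.
Qed.

Local Notation z := (y ^+ 2).

Let qE : q = x ^+ 2 * z. Proof. exact: exprMn. Qed.
Let z0 : z != 0. Proof. by rewrite expf_neq0. Qed.
Let q0 : q != 0 := xdelta2_neq0.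

(** The product of [rpos] at 2 n and 2 n + 1 is the ratio t_(n+1) / t_n, because x ^ 2 q ^ (2n+1) =
    q (x q ^ n) ^ 2. *)
Lemma Epos_double n : Epos n.*2 = tterm q u x n.
Proof.
elim: n => [|n IHn]; first by rewrite Epos0 /tterm big_ord0.
rewrite doubleS !EposS IHn ttermS /rpos /= odd_double doubleK /xa.
rewrite /= (exprS q) -addnn exprD.
have := fil_xa n; rewrite /xa => /(filMl fil smu) /(filV fil)[h _].
move: (q ^+ n) (tterm _ _ _ _) h => Q t h.
by rewrite qE; field; rewrite h.
Qed.

Lemma Eneg_doubleS n : Eneg n.*2.+1 = - z * tterm q u (x * z) n.
Proof.
elim: n => [|n IHn]; first by rewrite EnegS Eneg0 /tterm big_ord0 /rneg /= mul1r.
rewrite doubleS 2!EnegS IHn ttermS /rneg /= odd_double uphalf_double /xb.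
rewrite /= !(exprS q) -addnn exprD.
have := fil_xb n; rewrite /xb => /(filMl fil smu) /(filV fil)[h _].
move: (q ^+ n) (tterm _ _ _ _) h => Q t h.
by rewrite qE; field; rewrite h.
Qed.

(** [Epos] at 2 n + 2 is t_(n+1), and removing its last factor - x ^ 2 q ^ (2n+1) multiplies it by -
    z / q ^ (2n+2). *)
Lemma Epos_pair n : tterm q u x n.+1 * (1 - z / q ^+ n.+1 ^+ 2) =
  Epos n.*2.+1 + Epos n.*2.+2.
Proof.
rewrite -Epos_double doubleS (EposS n.*2.+1) /rpos /= odd_double /=.
rewrite /= !(exprS q) -addnn exprD.
have := expf_neq0 n q0; move: (q ^+ n) (Epos _) => Q t Q0.
by rewrite qE; field; rewrite Q0 x0 y0.
Qed.

Lemma Eneg_pair n : - z * tterm q u (x * z) n.+1 * (1 - z^-1 / q ^+ n.+1 ^+ 2) =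
  Eneg n.*2.+2 + Eneg n.*2.+3.
Proof.
rewrite -Eneg_doubleS doubleS (EnegS n.*2.+2) /rneg /= odd_double /=.
rewrite /= !(exprS q) -addnn exprD.
have := expf_neq0 n q0; move: (q ^+ n) (Eneg _) => Q t Q0.
by rewrite qE; field; rewrite Q0 x0 y0.
Qed.

(** The two terms outside the pairs, [Epos 0] and [Eneg 1], give the central term 1 - z. *)
Lemma sum_pairs N : \sum_(k < N.*2.+1) (Epos k + Eneg k.+1) =
  1 - z + \sum_(n < N) (Epos n.*2.+1 + Epos n.*2.+2)
  + \sum_(n < N) (Eneg n.*2.+2 + Eneg n.*2.+3).
Proof.
elim: N => [|N IHN].
  rewrite big_ord_recl !big_ord0 !addr0 /= Epos0 EnegS Eneg0 /rneg /=.
  by rewrite mul1r mulr1.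
by rewrite doubleS 2!big_ord_recr IHN !(big_ord_recr N) /=; ring.
Qed.

Let smq : sm 1 q := fil_xdelta2.
Let smx2 : sm 1 (x ^+ 2) := fil_sqr smx.
Let smz : sm 1 z := fil_sqr smy.

Let nz a n : sm 1 a -> qpoch q a n != 0.
Proof. by move=> ha; apply: qpoch_neq0 => k; apply: (qpoch_factor_neq0 fil smq). Qed.

(** The weight of the finite identity without its u-factors. The lengths are independent because x ^
    2 and z exchange theirs between the two halves. *)
Definition weight N j1 j2 j3 j4 := qpoch q q (N + N) /
  (qpoch q q j1 * qpoch q q j2 * (qpoch q (x ^+ 2) j3 * qpoch q z j4)).

Definition Dpart N := qpoch q q N * (qpoch q (x ^+ 2) N * qpoch q z N).

Lemma fil0_weight N j1 j2 j3 j4 : sm 0 (weight N j1 j2 j3 j4).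
Proof.
rewrite /weight !invfM; apply: (filMl fil); first exact: fil0_qpoch.
by apply: (filMl fil); apply: (filMl fil); apply: (fil0_qpochV fil smq).
Qed.

Lemma fil0_Dpart N : sm 0 (Dpart N).
Proof. by do 2?apply: (filMl fil); apply: (fil0_qpoch fil smq). Qed.

Lemma weight_congr d N j1 j2 j3 j4 : (d <= N)%N ->
  (d <= j1)%N -> (d <= j2)%N -> (d <= j3)%N -> (d <= j4)%N ->
  sm d (weight N j1 j2 j3 j4 * Dpart N - 1).
Proof.
move=> hN h1 h2 h3 h4.
(* Here 1 is the same expression with every length equal to N, so that the factors can be compared
   one by one. *)
have -> : 1 = qpoch q q N / (qpoch q q N * qpoch q q N * (qpoch q (x ^+ 2) N * qpoch q z N))
    * Dpart N.
  rewrite /Dpart; have := (nz N smq, nz N smx2, nz N smz).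
  move: (qpoch q q N) (qpoch q (x ^+ 2) N) (qpoch q z N) => P1 P2 P3 [[p1 p2] p3].
  by field; rewrite p1 p2 p3.
rewrite -mulrBl; apply: (filMr fil); last exact: fil0_Dpart.
have hV a j : sm 1 a -> sm 0 (qpoch q a j)^-1 by move=> ha; apply: (fil0_qpochV fil smq).
have hVc a j : sm 1 a -> (d <= j)%N -> sm d ((qpoch q a j)^-1 - (qpoch q a N)^-1).
  by move=> ha hj; apply: (qpochV_congr fil smq).
rewrite /weight !invfM; apply: (fil_mul_congr fil).
- exact: fil0_qpoch.
- by do ?apply: (filMl fil); apply: hV.
- by apply: (qpoch_congr fil smq) => //; apply: leq_trans hN (leq_addr _ _).
by do ?apply: (fil_mul_congr fil); do ?apply: (filMl fil); do ?[exact: hV|exact: hVc].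
Qed.

(** There are two reasons for a term to be unaffected by its weight modulo order d: it has order d
    itself, or all lengths are at least d and [weight_congr] applies. *)
Lemma weighted_term_congr d N e s j1 j2 j3 j4 : sm e s ->
  (d <= e)%N \/ [&& (d <= N)%N, (d <= j1)%N, (d <= j2)%N, (d <= j3)%N & (d <= j4)%N] ->
  sm d (s - s * weight N j1 j2 j3 j4 * Dpart N).
Proof.
move=> hs hd; rewrite -mulrA -[X in X - _]mulr1 -mulrBr.
rewrite -opprB mulrN; apply: (filN fil); case: hd => [hd|/and5P[h0 h1 h2 h3 h4]].
  apply: (filMr fil); first exact: fil_le hs.
  apply/(filB fil)/(fil1 fil)/(filMl fil); [exact: fil0_weight|exact: fil0_Dpart].
by apply: (filMl fil); [exact: fil_ge0 hs|exact: weight_congr].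
Qed.

Definition Apart N := qpoch q (u * x) N * qpoch q (u * (x * z)) N.

(** The finite identity of order N, multiplied by [Dpart N], is compared term by term with the
    partial sum over W multiplied by [Apart N]. *)
Lemma limit_congr d N : (d.*2 <= N)%N ->
  sm d ((\sum_(k < N.*2.+1) (Epos k + Eneg k.+1)) * Apart N - Dpart N).
Proof.
move=> hN; have hdN : (d <= N)%N by apply: leq_trans hN; rewrite -addnn leq_addr.
have smux : sm 1 (u * x) by apply: (filMl fil).
have smuxz : sm 1 (u * (x * z)) by apply/(filMl fil)/fil_xy2.
have smA : sm 0 (Apart N) by apply: (filMl fil); apply: (fil0_qpoch fil smq).
have nzf a k : sm 1 a -> 1 - a * q ^+ k != 0 by apply: (qpoch_factor_neq0 fil smq).
have key : wzF q u x z N 0 + wzU q u x z N + wzU q u (x * z) z^-1 N = 1.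
  by apply: wz_bilateral => // n; rewrite ?mulrA; apply: nzf; rewrite -?mulrA.
have eF r n : wzF q u x z r n = tterm q u x n * (1 - z / q ^+ n ^+ 2)
    * weight (r + n) r (r + n + n) (r + n + n) r.+1 * Apart (r + n).
  by rewrite /wzF /numC /weight /Apart; ring.
have eF' r n : wzF q u (x * z) z^-1 r n = - z * tterm q u (x * z) n * (1 - z^-1 / q ^+ n ^+ 2)
    * weight (r + n) r (r + n + n) r (r + n + n).+1 * Apart (r + n).
  rewrite wzF_refl //; first by rewrite /numC /weight /Apart; ring.
  - by move=> k; apply: nzf.
  - by move=> k; apply: nzf.
  - by move=> k; apply: nzf.
have split3 (a b c a' b' c' A D : K) :
  (a + b + c) * A - (a' + b' + c') * D = (a * A - a' * D) + (b * A - b' * D) + (c * A - c' * D).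
  by ring.
have fil_term e s r n j1 j2 j3 j4 : sm e s -> (r + n = N)%N ->
    (d <= e)%N \/ [&& (d <= N)%N, (d <= j1)%N, (d <= j2)%N, (d <= j3)%N & (d <= j4)%N] ->
    sm d (s * Apart N - s * weight (r + n) j1 j2 j3 j4 * Apart (r + n) * Dpart N).
  move=> hs -> hd; rewrite (_ : _ - _ = (s - s * weight N j1 j2 j3 j4 * Dpart N) * Apart N).
    by apply: (filMr fil) smA; apply: weighted_term_congr hs hd.
  by ring.
(* The bound 2 d <= N enters here: of two numbers with sum N, one is at least d. *)
have hcase r n : (r + n = N)%N -> (d <= n)%N \/ (d <= r)%N.
  move=> hrn; case: (leqP d n) => [|ltnd]; [by left|right].
  rewrite -(leq_add2r n) hrn (leq_trans _ hN) // -addnn leq_add2l.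
  exact: ltnW.
(* By [key], [Dpart N] may be multiplied by the finite sum; the difference then splits into the
   centre and the two halves. *)
rewrite sum_pairs -[Dpart N]mul1r -[X in _ - X * _]key split3 /wzU !mulr_suml -!sumrB.
apply: (filD fil); first apply: (filD fil).
- rewrite eF /tterm big_ord0 expr0 expr1n divr1 mul1r.
  apply: (fil_term 0%N); rewrite ?addn0 //; last by right; rewrite hdN leqW.
  exact/(filB fil)/(fil_ge0 fil smz)/(fil1 fil).
- apply: (fil_sum fil) => n _; rewrite eF Epos_pair.
  have e : (N - n.+1 + n.+1 = N)%N by rewrite subnK.
  apply: (fil_term n.+1) => //.
    have le2 : (n < n.*2.+1)%N by rewrite ltnS -addnn leq_addr.
    by apply: (filD fil); apply: fil_le (fil_Epos _) => //; apply: leqW.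
  case: (hcase _ _ e) => h; [by left|right].
  by rewrite hdN h leqW // -!addnA !(leq_trans h) ?leq_addr.
apply: (fil_sum fil) => n _; rewrite eF' Eneg_pair.
have e : (N - n.+1 + n.+1 = N)%N by rewrite subnK.
apply: (fil_term n.+1) => //.
  have le2 : (n < n.*2.+1)%N by rewrite ltnS -addnn leq_addr.
  by apply: (filD fil); apply: (fil_le fil _ (fil_Eneg _)); [apply: leqW|apply/leqW/leqW].
case: (hcase _ _ e) => h; [by left|right].
by rewrite hdN h leqW // -!addnA !(leq_trans h) ?leq_addr.
Qed.

End Smallness.
End Orbit.

(** * Power series through polynomials truncated by degree *)

Section Truncation.
Variable R : idomainType.
Implicit Types (p q f g : {mpoly R[2]}) (F G H : series R) (d e : nat).

Definition low d p := forall m : 'X_{1..2}, (mdeg m < d)%N -> p@_m = 0.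

Lemma low_0 d : low d 0.
Proof. by move=> m _; rewrite mcoeff0. Qed.

Lemma lowD d p q : low d p -> low d q -> low d (p + q).
Proof. by move=> hp hq m hm; rewrite mcoeffD hp // hq // addr0. Qed.

Lemma lowN d p : low d p -> low d (- p).
Proof. by move=> hp m hm; rewrite mcoeffN hp // oppr0. Qed.

Lemma lowB d p q : low d p -> low d q -> low d (p - q).
Proof. by move=> hp hq; apply/lowD/lowN. Qed.

Lemma low_le e d p : (e <= d)%N -> low d p -> low e p.
Proof. by move=> le_ed hp m hm; apply/hp/(leq_trans hm). Qed.

Lemma lowM d e p q : low d p -> low e q -> low (d + e) (p * q).
Proof.
move=> hp hq m hm; rewrite mcoeffM big1 // => -[k1 k2] /= /eqP mE.
have [lt1|le1] := ltnP (mdeg k1) d; first by rewrite hp ?mul0r.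
rewrite hq ?mulr0 //; move/(congr1 (@mdeg 2)): mE; rewrite mdegD => mE.
rewrite -(ltn_add2l (mdeg k1)) -[X in (X < _)%N]mE.
by rewrite (leq_trans hm) ?leq_add2r.
Qed.

Lemma lowMl d p q : low d q -> low d (p * q).
Proof. exact: (@lowM 0). Qed.

Lemma lowMr d p q : low d p -> low d (p * q).
Proof. by rewrite mulrC; apply: lowMl. Qed.

Lemma lowX d p n : low d p -> low (d * n) (p ^+ n).
Proof.
move=> hp; elim: n => [|n IHn]; first by rewrite muln0.
by rewrite mulnS exprS; apply: lowM.
Qed.

Lemma low_monomial (m : 'X_{1..2}) : low (mdeg m) 'X_[m].
Proof. by move=> k hk; rewrite mcoeffX; case: eqP hk => // ->; rewrite ltnn. Qed.

Lemma low1_mcoeff0 p : p@_0 = 0 -> low 1 p.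
Proof. by move=> p0 m; rewrite ltnS leqn0 mdeg_eq0 => /eqP ->. Qed.

(* Inverse of q modulo terms of degree >= d, from the geometric series. *)
Definition trinv d q : {mpoly R[2]} :=
  (q@_0)^-1 *: \sum_(k < d) (1 - (q@_0)^-1 *: q) ^+ k.

Lemma trinvP d q : q@_0 \is a GRing.unit -> low d (1 - q * trinv d q).
Proof.
move=> q0; rewrite /trinv; set h := 1 - _ *: q.
have -> : 1 - q * ((q@_0)^-1 *: \sum_(k < d) h ^+ k) = h ^+ d.
  rewrite -scalerAr scalerAl (_ : _ *: q = 1 - h); last by rewrite /h; ring.
  by rewrite -opprB -[h ^+ d](subrK 1) subrX1; ring.
rewrite -[X in low X]mul1n; apply/lowX/low1_mcoeff0.
by rewrite mcoeffB mcoeffZ mcoeff1 eqxx mulVr ?subrr.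
Qed.

(** A unit constant term makes q invertible modulo degree d, with inverse [trinv d q]. *)
Lemma low_cancel d q p : q@_0 \is a GRing.unit -> low d (q * p) -> low d p.
Proof.
move=> q0 hqp.
have -> : p = (1 - q * trinv d q) * p + trinv d q * (q * p) by ring.
by apply: lowD; [apply/lowMr/trinvP|apply: lowMl].
Qed.

(** Laws of power series are proved through this relation: below any given degree the series are
    represented by polynomials, where the ring laws hold. *)
Definition rep d F p := forall m : 'X_{1..2}, (mdeg m < d)%N -> F m = p@_m.

Definition trunc d F : {mpoly R[2]} := \sum_(m : 'X_{1..2 < d}) F m *: 'X_[m].

Lemma truncP d F : rep d F (trunc d F).
Proof.
move=> m hm; rewrite /trunc raddf_sum (bigD1 (BMultinom hm)) //=.
rewrite mcoeffZ mcoeffX eqxx mulr1 big1 ?addr0 // => k kNm.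
rewrite mcoeffZ mcoeffX; case: eqP => [kE|]; last by rewrite mulr0.
by case/eqP: kNm; apply: val_inj.
Qed.

Arguments truncP : clear implicits.

Lemma rep_series_of d p : rep d (series_of p) p.
Proof. by []. Qed.

Arguments rep_series_of : clear implicits.

Lemma rep_le e d F p : (e <= d)%N -> rep d F p -> rep e F p.
Proof. by move=> le_ed hp m hm; apply/hp/(leq_trans hm). Qed.

Lemma rep_low d F p q : rep d F p -> (rep d F q <-> low d (p - q)).
Proof.
move=> hp; split=> h m hm; first by rewrite mcoeffB -hp // -h // subrr.
by apply/eqP; rewrite -subr_eq0 hp // -mcoeffB h.
Qed.

Lemma rep_mul d F G p q :
  rep d F p -> rep d G q -> rep d (series_mul F G) (p * q).
Proof.
move=> hp hq m hm; rewrite /series_mul mcoeffM.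
apply: eq_bigr => -[k1 k2] /= /eqP/(congr1 (@mdeg 2)); rewrite mdegD => mE.
by rewrite hp ?hq // (leq_ltn_trans _ hm) // [X in (_ <= X)%N]mE ?leq_addl ?leq_addr.
Qed.

Lemma series_mulC F G : series_mul F G =1 series_mul G F.
Proof.
move=> m; have hF := truncP (mdeg m).+1 F; have hG := truncP (mdeg m).+1 G.
by rewrite (rep_mul hF hG) // (rep_mul hG hF) // mulrC.
Qed.

Lemma series_mulA F G H :
  series_mul F (series_mul G H) =1 series_mul (series_mul F G) H.
Proof.
move=> m; have hF := truncP (mdeg m).+1 F; have hG := truncP (mdeg m).+1 G.
have hH := truncP (mdeg m).+1 H.
rewrite (rep_mul hF (rep_mul hG hH)) // (rep_mul (rep_mul hF hG) hH) //.
by rewrite mulrA.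
Qed.

Lemma eq_series_mul F F' G G' :
  F =1 F' -> G =1 G' -> series_mul F G =1 series_mul F' G'.
Proof. by move=> eF eG m; apply: eq_bigr => k _; rewrite eF eG. Qed.

Lemma series_mul1 F : series_mul F (series_of 1) =1 F.
Proof.
move=> m; have hF := truncP (mdeg m).+1 F.
by rewrite (rep_mul hF (rep_series_of _ 1)) // mulr1 hF.
Qed.

Lemma series_mul_coeff0 F G : series_mul F G 0%MM = F 0%MM * G 0%MM.
Proof.
have hF := truncP 1 F; have hG := truncP 1 G.
rewrite (rep_mul hF hG) ?mdeg0 // rmorphM /=.
by rewrite -hF ?mdeg0 // -hG ?mdeg0.
Qed.

Lemma series_mul_cancel F G H : F 0%MM \is a GRing.unit ->
  series_mul F G =1 series_mul F H -> G =1 H.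
Proof.
move=> F0 eFGH m; set d := (mdeg m).+1.
have [[hF hG] hH] := (truncP d F, truncP d G, truncP d H).
rewrite hG // hH //; apply/eqP; rewrite -subr_eq0 -mcoeffB; apply/eqP.
apply: (@low_cancel d (trunc d F)); rewrite -?hF ?mdeg0 // => k hk.
by rewrite mulrBr mcoeffB -(rep_mul hF hG) // -(rep_mul hF hH) // eFGH subrr.
Qed.

Definition series_div F G : series R := fun m =>
  (trunc (mdeg m).+1 F * trinv (mdeg m).+1 (trunc (mdeg m).+1 G))@_m.

Lemma rep_div d F G f g h : G 0%MM \is a GRing.unit ->
  rep d F f -> rep d G g -> low d (f - g * h) -> rep d (series_div F G) h.
Proof.
move=> G0 hF hG hfgh m hm; rewrite /series_div; set e := (mdeg m).+1.
have [tF tG] := (truncP e F, truncP e G).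
have lF : low e (trunc e F - f) by apply/(rep_low _ tF)/(rep_le hm).
have lG : low e (trunc e G - g) by apply/(rep_low _ tG)/(rep_le hm).
have tG0 : (trunc e G)@_0 \is a GRing.unit by rewrite -tG ?mdeg0.
apply/eqP; rewrite -subr_eq0 -mcoeffB; apply/eqP.
apply: (@low_cancel e (trunc e G)) => //.
have -> : trunc e G * (trunc e F * trinv e (trunc e G) - h) =
  - (trunc e F * (1 - trunc e G * trinv e (trunc e G)))
  + (trunc e F - f) + (f - g * h) - (trunc e G - g) * h by ring.
apply: lowB; last exact: lowMr.
apply: lowD; last exact: low_le hfgh.
by apply: lowD => //; apply/lowN/lowMl/trinvP.
Qed.

Lemma series_divP F G : G 0%MM \is a GRing.unit ->
  series_mul G (series_div F G) =1 F.
Proof.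
move=> G0 m; set d := (mdeg m).+1.
have [hF hG] := (truncP d F, truncP d G).
have hdiv : low d (trunc d F - trunc d G * (trunc d F * trinv d (trunc d G))).
  rewrite mulrCA -[X in X - _]mulr1 -mulrBr; apply/lowMl/trinvP.
  by rewrite -hG ?mdeg0.
rewrite (rep_mul hG (rep_div G0 hF hG hdiv)) //.
by apply/esym; rewrite ((rep_low _ hF).2 hdiv).
Qed.

End Truncation.

Arguments truncP {R} d F m _.
Arguments rep_series_of {R} d p m _.

(** * Rational functions regular at the origin and their expansions *)

Section Regular.
Variable R : idomainType.
Implicit Types (p q : {mpoly R[2]}) (f g h : ratfun R) (F G H : series R).

(* f lies in the d-th power of the maximal ideal of the local ring at 0. *)
Definition small d f := exists p q : {mpoly R[2]},
  [/\ q@_0 \is a GRing.unit, low d p & f = p%:F / q%:F].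

Lemma unit_neq0 q : q@_0 \is a GRing.unit -> q%:F != 0.
Proof. by rewrite tofrac_eq0; apply: contraTneq => ->; rewrite mcoeff0 unitr0. Qed.

Lemma small_poly d p : low d p -> small d p%:F.
Proof.
by move=> hp; exists p, 1; rewrite mcoeff1 eqxx unitr1 tofrac1 divr1; split.
Qed.

Lemma small_polyE d p : small d p%:F -> low d p.
Proof.
move=> [p' [q [q0 hp' e]]]; apply: (low_cancel q0).
suff -> : q * p = p' by [].
by apply/eqP; rewrite -tofrac_eq tofracM e mulrC divfK ?unit_neq0.
Qed.

Lemma smallD d f g : small d f -> small d g -> small d (f + g).
Proof.
move=> [p [q [q0 hp ->]]] [p' [q' [q0' hp' ->]]].
exists (p * q' + p' * q), (q * q'); split.
- by rewrite rmorphM unitrM q0.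
- by apply: lowD; apply: lowMr.
- by rewrite addf_div ?unit_neq0 // -!tofracM -tofracD.
Qed.

Lemma smallN d f : small d f -> small d (- f).
Proof.
move=> [p [q [q0 hp ->]]]; exists (- p), q; split=> //; first exact: lowN.
by rewrite tofracN mulNr.
Qed.

Lemma smallB d f g : small d f -> small d g -> small d (f - g).
Proof. by move=> hf hg; apply/smallD/smallN. Qed.

Lemma smallM d e f g : small d f -> small e g -> small (d + e) (f * g).
Proof.
move=> [p [q [q0 hp ->]]] [p' [q' [q0' hp' ->]]].
exists (p * p'), (q * q'); split.
- by rewrite rmorphM unitrM q0.
- exact: lowM.
- by rewrite mulf_div -!tofracM.
Qed.

Lemma small_le e d f : (e <= d)%N -> small d f -> small e f.
Proof.
by move=> le_ed [p [q [q0 hp ->]]]; exists p, q; split=> //; apply: low_le hp.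
Qed.

Lemma smallMl d f g : small 0 f -> small d g -> small d (f * g).
Proof. exact: smallM. Qed.

Lemma smallMr d f g : small d f -> small 0 g -> small d (f * g).
Proof. by move=> hf hg; rewrite mulrC; apply: smallMl. Qed.

Lemma small1 : small 0 1.
Proof. by rewrite -tofrac1; apply: small_poly. Qed.

Lemma small_0 d : small d 0.
Proof. by rewrite -tofrac0; apply/small_poly/low_0. Qed.

Lemma small_sum d (I : Type) (s : seq I) (P : pred I) (f : I -> ratfun R) :
  (forall i, P i -> small d (f i)) -> small d (\sum_(i <- s | P i) f i).
Proof. by move=> hf; elim/big_ind: _ => //; [exact: small_0|apply: smallD]. Qed.

(** Compares a rational function with a power series through a polynomial congruent to both modulo
    order d. *)
Definition approx d f F := exists p : {mpoly R[2]}, rep d F p /\ small d (f - p%:F).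

Lemma approx_poly d p : approx d p%:F (series_of p).
Proof. by exists p; rewrite subrr; split=> //; apply: small_0. Qed.

Lemma approx_rep d f F p : approx d f F -> rep d F p -> small d (f - p%:F).
Proof.
move=> [q [hq hfq]] /(rep_low _ hq) hp.
have -> : f - p%:F = (f - q%:F) + (q - p)%:F by rewrite tofracB; ring.
by apply/smallD/small_poly.
Qed.

Lemma approx_small0 d f F : approx d f F -> small 0 f.
Proof.
move=> [p [hp hfp]]; rewrite -[f](subrK p%:F).
by apply: smallD; [apply: small_le hfp|apply: small_poly].
Qed.

Lemma approx_mul d f g F G :
  approx d f F -> approx d g G -> approx d (f * g) (series_mul F G).
Proof.
move=> hf hg; case: (hf) => [p [hp hfp]]; case: (hg) => [q [hq hgq]].
exists (p * q); split; first exact: rep_mul.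
have -> : f * g - (p * q)%:F = (f - p%:F) * g + p%:F * (g - q%:F).
  by rewrite tofracM; ring.
apply: smallD; first by apply: smallMr (approx_small0 hg).
by apply: smallMl => //; apply: small_poly.
Qed.

Lemma approx_congr d f g F : approx d f F -> small d (f - g) -> approx d g F.
Proof.
move=> [p [hp hfp]] hfg; exists p; split=> //.
by rewrite (_ : g - _ = (f - p%:F) - (f - g)); [apply: smallB|ring].
Qed.

Lemma approx_ext d f F G :
  (forall m : 'X_{1..2}, (mdeg m < d)%N -> F m = G m) -> approx d f F -> approx d f G.
Proof.
by move=> eFG [p [hp hfp]]; exists p; split=> // m hm; rewrite -eFG ?hp.
Qed.

Lemma approx_eq d f F G (m : 'X_{1..2}) :
  approx d f F -> approx d f G -> (mdeg m < d)%N -> F m = G m.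
Proof.
move=> [p [hp hfp]] [q [hq hfq]] hm; rewrite hp // hq //.
apply/eqP; rewrite -subr_eq0 -mcoeffB; apply/eqP.
apply: (@small_polyE d) hm.
rewrite tofracB (_ : _ - _ = (f - q%:F) - (f - p%:F)); last by ring.
exact: smallB.
Qed.

Lemma approx_sum d (I : Type) (s : seq I) (f : I -> ratfun R) (F : I -> series R) :
  (forall i, approx d (f i) (F i)) ->
  approx d (\sum_(i <- s) f i) (fun m => \sum_(i <- s) F i m).
Proof.
move=> hfF; exists (\sum_(i <- s) trunc d (F i)); split.
  by move=> m hm; rewrite raddf_sum /=; apply: eq_bigr => i _; rewrite -truncP.
rewrite rmorph_sum -sumrB; apply: small_sum => i _.
exact: (approx_rep (hfF i) (truncP _ _)).
Qed.

Lemma approx_expansion d f F : is_expansion f F -> approx d f F.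
Proof.
move=> [p [q [-> [q0 eF]]]]; exists (trunc d F); split; first exact: truncP.
exists (p - q * trunc d F), q; split=> // [|].
  move=> m hm; rewrite mcoeffB.
  have hq := rep_series_of d q.
  by rewrite -(rep_mul hq (truncP d F)) // eF subrr.
by rewrite tofracB tofracM mulrBl [q%:F * _]mulrC mulfK ?unit_neq0.
Qed.

Lemma expansion_unique f F G : is_expansion f F -> is_expansion f G -> F =1 G.
Proof.
move=> /approx_expansion hF /approx_expansion hG m.
exact: (approx_eq (hF (mdeg m).+1) (hG _)).
Qed.

(** Stated in [Type], so that a family of series over W can be defined from it; the boolean form
    [ex] lets [xchoose] extract a numerator and a denominator. *)
Lemma expansion_exists f : small 0 f -> {F : series R | is_expansion f F}.
Proof.
move=> hf.
have ex : exists pq : {mpoly R[2]} * {mpoly R[2]},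
    (pq.2@_0 \is a GRing.unit) && (f == pq.1%:F / pq.2%:F).
  by case: hf => [p [q [q0 _ ->]]]; exists (p, q); rewrite /= q0 eqxx.
have := xchooseP ex; case: (xchoose ex) => p q /= /andP[q0 /eqP ->].
exists (series_div (series_of p) (series_of q)), p, q; split=> //.
by split=> //; apply: series_divP.
Qed.

End Regular.

(** * Unconditional sums and products *)

Section Limits.
Variable R : idomainType.
Implicit Types (p q : {mpoly R[2]}) (F G P : series R).

Lemma stabilizes_unique (I : eqType) (G : seq I -> R) (c c' : R) :
  stabilizes G c -> stabilizes G c' -> c = c'.
Proof.
move=> [s hs] [s' hs']; rewrite -(hs (undup (s ++ s'))) ?undup_uniq //.
  by rewrite hs' ?undup_uniq // => i hi; rewrite mem_undup mem_cat hi orbT.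
by move=> i hi; rewrite mem_undup mem_cat hi.
Qed.

Lemma is_prod_unique (I : eqType) (F : I -> {mpoly R[2]}) P P' :
  is_prod F P -> is_prod F P' -> P =1 P'.
Proof. by move=> h h' m; apply: stabilizes_unique (h m) (h' m). Qed.

Lemma is_sum_unique (I : eqType) (F F' : I -> series R) P P' :
  (forall i, F i =1 F' i) -> is_sum F P -> is_sum F' P' -> P =1 P'.
Proof.
move=> eF h h' m; apply: stabilizes_unique (h' m).
have [s hs] := h m; exists s => t ut st.
by rewrite -(hs t ut st); apply: eq_bigr => i _; rewrite eF.
Qed.

Lemma perm_cat_filter (I : eqType) (s t : seq I) :
  uniq s -> uniq t -> {subset s <= t} ->
  perm_eq t (s ++ [seq i <- t | i \notin s]).
Proof.
move=> us ut st; rewrite perm_sym; apply: perm_trans (permEl (perm_filterC (mem s) t)).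
rewrite perm_cat2r.
apply: uniq_perm => // [|i]; first exact: filter_uniq.
by rewrite mem_filter /=; case: (boolP (i \in s)) => // /st ->.
Qed.

Lemma low_prod1 d (I : eqType) (F : I -> {mpoly R[2]}) (s : seq I) :
  {in s, forall i, low d (F i - 1)} -> low d (\prod_(i <- s) F i - 1).
Proof.
elim: s => [|i s IHs] hs; first by rewrite big_nil subrr; apply: low_0.
rewrite big_cons (_ : _ - 1 =
  (F i - 1) * \prod_(j <- s) F j + (\prod_(j <- s) F j - 1)); last by ring.
apply: lowD; first by apply/lowMr/hs; rewrite mem_head.
by apply: IHs => j hj; apply: hs; rewrite inE hj orbT.
Qed.

Lemma low_prod_subset d (I : eqType) (F : I -> {mpoly R[2]}) (s t : seq I) :
  uniq s -> uniq t -> {subset s <= t} ->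
  (forall i, i \notin s -> low d (F i - 1)) ->
  low d (\prod_(i <- s) F i - \prod_(i <- t) F i).
Proof.
move=> us ut st hF; rewrite (perm_big _ (perm_cat_filter us ut st)) big_cat /=.
rewrite -[X in X - _]mulr1 -mulrBr; apply: lowMl.
rewrite -opprB; apply/lowN/low_prod1 => i.
by rewrite mem_filter => /andP[/hF].
Qed.

Variables (I : eqType) (F : I -> {mpoly R[2]}) (s : nat -> seq I).
Hypothesis s_uniq : forall d, uniq (s d).
Hypothesis low_F : forall d i, i \notin s d -> low d (F i - 1).

(** A coefficient of degree e is read off the product over [s e.+1], outside which every factor is 1
    modulo degree e + 1. *)
Definition lim_prod : series R := fun m => (\prod_(i <- s (mdeg m).+1) F i)@_m.

Lemma lim_prodP : is_prod F lim_prod.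
Proof.
move=> m; exists (s (mdeg m).+1) => t ut st; apply/esym/eqP.
rewrite -subr_eq0 -mcoeffB; apply/eqP.
exact: (low_prod_subset _ ut st (@low_F _)).
Qed.

Hypothesis s_mono : forall d e, (d <= e)%N -> {subset s d <= s e}.

Lemma rep_lim_prod d e : (d <= e)%N -> rep d lim_prod (\prod_(i <- s e) F i).
Proof.
move=> le_de m hm; apply/eqP; rewrite -subr_eq0 -mcoeffB; apply/eqP.
apply: (@low_prod_subset (mdeg m).+1) => //; last exact: low_F.
by apply: s_mono; apply: leq_trans le_de.
Qed.

End Limits.

Section LimitsTheory.
Variable R : idomainType.
Implicit Types (F P : series R).

Lemma is_prod_coeff0 (I : eqType) (F : I -> {mpoly R[2]}) P :
  is_prod F P -> (forall i, low 1 (F i - 1)) -> P 0%MM = 1.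
Proof.
move=> hP hF; have [t ht] := hP 0%MM.
rewrite -(ht (undup t)) ?undup_uniq // => [|i]; last by rewrite mem_undup.
have h1 : (1 : {mpoly R[2]})@_0 = 1 by rewrite mcoeff1 eqxx.
apply/eqP; rewrite -subr_eq0 -[X in _ - X]h1 -mcoeffB; apply/eqP.
by apply: (low_prod1 (d := 1)); rewrite ?mdeg0.
Qed.

Lemma is_prod_ext (I : eqType) (F F' : I -> {mpoly R[2]}) P :
  F =1 F' -> is_prod F P -> is_prod F' P.
Proof.
move=> eF hP m; have [t ht] := hP m; exists t => s us st.
by rewrite -(ht s us st); congr mcoeff; apply: eq_bigr => i _; rewrite eF.
Qed.

Lemma stabilizes_sum (I : eqType) (F : I -> R) (s : seq I) :
  uniq s -> (forall i, i \notin s -> F i = 0) ->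
  stabilizes (fun t : seq I => \sum_(i <- t) F i) (\sum_(i <- s) F i).
Proof.
move=> us hF; exists s => t ut st.
rewrite (perm_big _ (perm_cat_filter us ut st)) big_cat /= [X in _ + X]big1_seq ?addr0 //.
by move=> i /=; rewrite mem_filter => /andP[/hF].
Qed.

Variables a p : {mpoly R[2]}.
Hypotheses (a1 : low 1 a) (p1 : low 1 p).

Lemma low_qfactor k : low k.+1 (1 - a * p ^+ k - 1).
Proof.
rewrite addrAC subrr sub0r; apply: lowN.
by have := lowM a1 (@lowX R 1 p k p1); rewrite mul1n.
Qed.

Definition qprod : series R := lim_prod (fun k => 1 - a * p ^+ k) (iota 0).

Let low_iota_factor d k : k \notin iota 0 d -> low d (1 - a * p ^+ k - 1).
Proof.
rewrite mem_iota add0n /= -leqNgt => dk.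
by apply: low_le (@low_qfactor k); apply: leqW.
Qed.

Lemma qprodP : is_qpochhammer a p qprod.
Proof. by apply: lim_prodP => // d; apply: iota_uniq. Qed.

Lemma approx_qprod d N : (d <= N)%N -> approx d (qpoch p%:F a%:F N) qprod.
Proof.
move=> dN; exists (\prod_(k <- iota 0 N) (1 - a * p ^+ k)); split.
  apply: rep_lim_prod => // [e|e e' le_e k]; first exact: iota_uniq.
  by rewrite !mem_iota !add0n /= => /leq_trans; apply.
rewrite [X in _ - X](_ : _ = qpoch p%:F a%:F N) ?subrr; first exact: small_0.
rewrite rmorph_prod /qpoch -(big_mkord xpredT (fun k => 1 - a%:F * p%:F ^+ k)).
by rewrite /index_iota subn0; apply: eq_bigr => k _; rewrite /= tofracB tofracM tofracXn.
Qed.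

Lemma qprod_coeff0 : qprod 0%MM = 1.
Proof. by apply: is_prod_coeff0 qprodP _ => k; apply: low_le (@low_qfactor k). Qed.

End LimitsTheory.

(** * Reflections as endomorphisms of the field of rational functions *)

Section Reflections.
Variable R : idomainType.
Implicit Types (p q : {mpoly R[2]}) (f g : ratfun R) (i : 'I_2).

HB.instance Definition _ := GRing.RMorphism.copy (@cst R)
  (@FracField.tofrac {mpoly R[2]} \o @mpolyC 2 R).

Lemma var_neq0 i : var R i != 0.
Proof.
rewrite tofrac_eq0; apply/eqP => /(congr1 (mcoeff U_(i)%MM)) /eqP.
by rewrite mcoeffX eqxx mcoeff0 oner_eq0.
Qed.

Definition reflm i := mmap (@cst R) (@refl_var R i).

(** The exponent of x_i ^ N times the image of x^m under sigma_i; the power x_i ^ N keeps it natural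
    as long as m i <= N. *)
Definition refl_exp i N (m : 'X_{1..2}) : 'X_{1..2} :=
  [multinom if k == i then (N - m i + 2 * \sum_(l | l != i) m l)%N else m k | k < 2].

Lemma refl_exp_inj i N (m m' : 'X_{1..2}) : (m i <= N)%N -> (m' i <= N)%N ->
  refl_exp i N m = refl_exp i N m' -> m = m'.
Proof.
move=> hm hm' e.
have eN k : k != i -> m k = m' k.
  by move=> /negPf ki; have := congr1 (fun v : 'X_{1..2} => v k) e; rewrite !mnmE ki.
apply/mnmP => k; have [-> {k}|] := eqVneq k i; last exact: eN.
have := congr1 (fun v : 'X_{1..2} => v i) e; rewrite !mnmE eqxx.
rewrite (eq_bigr m') // => /eqP; rewrite eqn_add2r => /eqP eNi.
by rewrite -(subKn hm) eNi subKn.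
Qed.

Lemma mmap1_refl i N (m : 'X_{1..2}) : (m i <= N)%N ->
  var R i ^+ N * mmap1 (refl_var R i) m = ('X_[refl_exp i N m] : {mpoly R[2]})%:F.
Proof.
move=> hm; rewrite mpolyXE_id rmorph_prod /mmap1 (bigD1 i) //= [RHS](bigD1 i) //=.
rewrite mnmE eqxx /refl_var eqxx mulrA.
rewrite (eq_bigr (fun k => var R k ^+ m k * var R i ^+ (2 * m k))); last first.
  by move=> k /negPf ki; rewrite ki exprMn exprM.
rewrite big_split /= prodrXr -big_distrr /= mulrCA mulrC rmorphXn /= exprD.
congr (_ * _).
  by congr (_ * _); rewrite exprVn -[in LHS](subnK hm) exprD mulfK ?expf_neq0 ?var_neq0.
by apply: eq_bigr => k /negPf ki; rewrite mnmE ki rmorphXn.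
Qed.

(** After multiplication by x_i ^ N, where N bounds all exponents in p, distinct monomials go to
    distinct monomials and nothing cancels. *)
Lemma reflm_inj i p : reflm i p = 0 -> p = 0.
Proof.
move=> hp; set N := msize p.
have hN (m : 'X_{1..2}) : m \in msupp p -> (m i <= N)%N.
  move=> /msize_mdeg_lt/ltnW; apply: leq_trans.
  by rewrite mdegE (bigD1 i) //= leq_addr.
have e : \sum_(m <- msupp p) p@_m *: 'X_[refl_exp i N m] = 0 :> {mpoly R[2]}.
  apply/eqP; rewrite -tofrac_eq0 -(mulr0 (var R i ^+ N)) -hp /reflm /mmap mulr_sumr.
  rewrite rmorph_sum /=; apply/eqP/eq_big_seq => m /hN hm.
  by rewrite mulrCA mmap1_refl // -mul_mpolyC rmorphM.
apply/mpolyP => m; rewrite mcoeff0; have [hm|] := boolP (m \in msupp p); last first.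
  by move/memN_msupp_eq0.
have := congr1 (mcoeff (refl_exp i N m)) e.
rewrite raddf_sum /= mcoeff0 (bigD1_seq m) //= big1_seq ?addr0.
  by rewrite mcoeffZ mcoeffX eqxx mulr1.
move=> m' /andP[m'Nm hm']; rewrite mcoeffZ mcoeffX.
case: eqP => [eg|]; last by rewrite mulr0.
by case/eqP: m'Nm; apply: refl_exp_inj eg; apply: hN.
Qed.

Lemma reflm_eq0 i p : (reflm i p == 0) = (p == 0).
Proof. by apply/eqP/eqP => [/reflm_inj|->] //; rewrite /reflm rmorph0. Qed.

Lemma repr_ratfun f : f = (\n_(repr f))%:F / (\d_(repr f))%:F.
Proof.
rewrite -{1}[f]reprK; unlock FracField.tofrac.
have -> (a b : {ratio {mpoly R[2]}}) :
    (\pi_(ratfun R) a : ratfun R) / (\pi_(ratfun R) b : ratfun R)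
    = \pi_(ratfun R) (FracField.mulf a (FracField.invf b)).
  by rewrite FracField.pi_mul FracField.pi_inv.
congr (\pi _); rewrite /FracField.invf /FracField.mulf.
by rewrite !numden_Ratio ?oner_eq0 ?denom_ratioP // mulr1 mul1r Ratio_numden.
Qed.

Lemma ratfunP f : exists p q, q != 0 /\ f = p%:F / q%:F.
Proof.
exists \n_(repr f), \d_(repr f); split; first exact: denom_ratioP.
exact: repr_ratfun.
Qed.

(** Equality of fractions, cross-multiplied, is an equality of polynomials, which [reflm] preserves;
    its injectivity keeps the denominators nonzero. *)
Lemma subst_reflE i p q : q != 0 ->
  subst_refl i (p%:F / q%:F) = reflm i p / reflm i q.
Proof.
move=> q0; rewrite /subst_refl -!/(reflm i _); set r := repr _.
have d0 : \d_r != 0 by apply: denom_ratioP.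
have e : \n_r * q = p * \d_r.
  apply/eqP; rewrite -tofrac_eq !tofracM -eqr_div ?tofrac_eq0 //.
  by rewrite -repr_ratfun.
apply/eqP; rewrite eqr_div ?reflm_eq0 //; apply/eqP.
by rewrite /reflm -!rmorphM e.
Qed.

Lemma subst_refl_zmod i : zmod_morphism (subst_refl i : ratfun R -> ratfun R).
Proof.
move=> f g; have [p [q [q0 ->]]] := ratfunP f; have [p' [q' [q'0 ->]]] := ratfunP g.
rewrite -mulNr -tofracN addf_div ?tofrac_eq0 // -!tofracM -tofracD.
rewrite !subst_reflE ?mulf_neq0 // -mulNr addf_div ?reflm_eq0 //.
by rewrite /reflm rmorphD !rmorphM rmorphN.
Qed.

Lemma subst_refl_monoid i : monoid_morphism (subst_refl i : ratfun R -> ratfun R).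
Proof.
split=> [|f g].
  by rewrite -[1 in LHS]divr1 -tofrac1 subst_reflE ?oner_eq0 // divff ?reflm_eq0 ?oner_eq0.
have [p [q [q0 ->]]] := ratfunP f; have [p' [q' [q'0 ->]]] := ratfunP g.
rewrite mulf_div -!tofracM !subst_reflE ?mulf_neq0 // mulf_div.
by rewrite /reflm !rmorphM.
Qed.

HB.instance Definition _ i := GRing.isZmodMorphism.Build (ratfun R) (ratfun R)
  (@subst_refl R i) (subst_refl_zmod i).
HB.instance Definition _ i := GRing.isMonoidMorphism.Build (ratfun R) (ratfun R)
  (@subst_refl R i) (subst_refl_monoid i).

Lemma subst_refl_poly i p : subst_refl i p%:F = reflm i p.
Proof.
by rewrite -[p%:F]divr1 -tofrac1 subst_reflE ?oner_eq0 // /reflm rmorph1 divr1.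
Qed.

Lemma subst_refl_cst i (c : R) : subst_refl i (cst c) = cst c.
Proof. by rewrite subst_refl_poly /reflm mmapC. Qed.

Lemma subst_refl_var i j : subst_refl i (var R j) = refl_var R i j.
Proof. by rewrite subst_refl_poly /reflm mmapX mmap1U. Qed.

End Reflections.

(** * The orbit of 1 in the field of rational functions *)

Section Instance.
Variables (R : idomainType) (u : R).

Lemma small_one_sub (f : ratfun R) : small 1 f -> 1 - f != 0 /\ small 0 (1 - f)^-1.
Proof.
move=> [p [q [q0 hp ->]]].
have e : (q - p)@_0 = q@_0 by rewrite mcoeffB (hp 0%MM) ?mdeg0 // subr0.
have qp0 : (q - p)@_0 \is a GRing.unit by rewrite e.
have -> : 1 - p%:F / q%:F = (q - p)%:F / q%:F.
  by rewrite tofracB mulrBl divff ?unit_neq0.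
split; first by rewrite mulf_neq0 ?invr_eq0 ?unit_neq0.
by exists q, (q - p); rewrite invf_div.
Qed.

Lemma small_filtration : filtration (@small R).
Proof.
split; [exact: small_0|exact: small1|exact: smallB|exact: smallM|exact: small_le|].
exact: small_one_sub.
Qed.

Local Notation K := (ratfun R).
Local Notation x := (var R ord0).
Local Notation y := (var R ord_max).
Local Notation U := (cst u).

Lemma small1_var i : small 1 (var R i).
Proof. by apply: small_poly; have := @low_monomial R U_(i)%MM; rewrite mdeg1. Qed.

Lemma small0_cst : small 0 U.
Proof. exact: small_poly. Qed.

Lemma x_sub_cst_neq0 : x - U != 0.
Proof.
rewrite -tofracB tofrac_eq0; apply/eqP => /(congr1 (mcoeff U_(ord0)%MM)) /eqP.
rewrite mcoeffB mcoeffX eqxx mcoeffC mcoeff0 (_ : (U_(ord0) == 0)%MM = false).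
  by rewrite mulr0 subr0 oner_eq0.
by apply/eqP => /(congr1 (@mdeg 2)); rewrite mdeg1 mdeg0.
Qed.

Lemma one_sub_cst_x_neq0 : 1 - U * x != 0.
Proof. by case: (small_one_sub (smallMl small0_cst (small1_var ord0))). Qed.

Lemma refl0_x : subst_refl ord0 x = x^-1.
Proof. by rewrite subst_refl_var /refl_var eqxx. Qed.

Lemma refl0_y : subst_refl ord0 y = y * x ^+ 2.
Proof. by rewrite subst_refl_var. Qed.

Lemma refl1_x : subst_refl ord_max x = x * y ^+ 2.
Proof. by rewrite subst_refl_var. Qed.

Lemma refl1_y : subst_refl ord_max y = y^-1.
Proof. by rewrite subst_refl_var /refl_var eqxx. Qed.

(** Integers merge the two families: |m| is the length, and the sign tells the last letter of the
    reduced word. *)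
Definition term (m : int) : K :=
  match m with Posz k => Epos x y U k | Negz k => Eneg x y U k.+1 end.

Lemma small_term m : small `|m| (term m).
Proof.
case: m => k; [apply: (fil_Epos small_filtration)|apply: (fil_Eneg small_filtration)];
  exact: small1_var || exact: small0_cst.
Qed.

Lemma slash0_Eneg k : slash u (Eneg x y U k) ord0 = Epos x y U k.+1.
Proof.
exact: (s0_Eneg (var_neq0 R ord0) (subst_refl_cst ord0 u) refl0_x refl0_y one_sub_cst_x_neq0).
Qed.

Lemma slash0_Epos k : slash u (Epos x y U k.+1) ord0 = Eneg x y U k.
Proof.
exact: (s0_Epos (var_neq0 R ord0) (subst_refl_cst ord0 u) refl0_x refl0_y
  one_sub_cst_x_neq0 x_sub_cst_neq0).
Qed.

Lemma slash1_Epos k : slash u (Epos x y U k) ord_max = Eneg x y U k.+1.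
Proof.
exact: (s1_Epos (var_neq0 R ord_max) (subst_refl_cst ord_max u) refl1_x refl1_y).
Qed.

Lemma slash1_Eneg k : slash u (Eneg x y U k.+1) ord_max = Epos x y U k.
Proof.
exact: (s1_Eneg (var_neq0 R ord_max) (subst_refl_cst ord_max u) refl1_x refl1_y).
Qed.

(* W acts simply transitively on the integers, sigma_0 by m |-> 1 - m and sigma_1
   by m |-> - 1 - m; the element w is encoded by the image of 0. *)
Definition step (i : 'I_2) (m : int) : int := (if i == ord0 then 1 else -1) - m.

Lemma ord2P (i : 'I_2) : i = ord0 \/ i = ord_max.
Proof. by case: i => -[|[|]] // h; [left|right]; apply: val_inj. Qed.

Lemma term_opp k : term (- k%:Z) = Eneg x y U k.
Proof. by case: k => [|k]; rewrite ?oppr0 /= ?Epos0 ?Eneg0 // -NegzE. Qed.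

Lemma slash_term i m : slash u (term m) i = term (step i m).
Proof.
rewrite /step; case: (ord2P i) => -> /=; case: m => k.
- case: k => [|k]; first by rewrite subr0 [term 1](esym (slash0_Eneg 0)) /= Epos0 Eneg0.
  by rewrite slash0_Epos intS opprD addrA subrr sub0r term_opp.
- by rewrite slash0_Eneg NegzE opprK.
- by rewrite slash1_Epos -opprD -intS term_opp.
by rewrite slash1_Eneg NegzE opprK intS addKr.
Qed.

Definition state (s : seq 'I_2) : int := foldl (fun m i => step i m) 0 s.

Lemma state_rcons s i : state (rcons s i) = step i (state s).
Proof. exact: foldl_rcons. Qed.

Lemma slash_wordE s : slash_word u 1 s = term (state s).
Proof.
elim/last_ind: s => [|s i IHs]; first by rewrite /= Epos0.
by rewrite state_rcons -slash_term -IHs /slash_word foldl_rcons.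
Qed.

End Instance.

(** * Enumeration of the Weyl group by the integers *)

Section Weyl.

Lemma word_mx_rcons s i : word_mx (rcons s i) = word_mx s *m srefl i.
Proof. by rewrite /word_mx big_rcons. Qed.

Lemma odd_step i m : odd `|step i m| = ~~ odd `|m|.
Proof. by rewrite /step; case: ifP => _; lia. Qed.

(** Column j is the image of alpha_j: for even m a translation, with images alpha_0 - m delta and
    alpha_1 + m delta; for odd m a reflection, with images alpha_1 - m delta and alpha_0 + m
    delta. *)
Definition state_mx (m : int) : 'M[int]_2 :=
  let o := odd `|m| in
  \matrix_(k, j)
    if k == ord0 then if j == ord0 then (~~ o)%:R - m else o%:R + m
    else if j == ord0 then o%:R - m else (~~ o)%:R + m.

Lemma state_mx_step m i : state_mx (step i m) = state_mx m *m srefl i.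
Proof.
apply/matrixP => k j; rewrite !mxE big_ord_recl big_ord1 !mxE odd_step negbK.
rewrite /step; case: (ord2P i) => ->; case: (ord2P k) => ->; case: (ord2P j) => ->;
  case: (odd _) => /=; lia.
Qed.

Lemma word_mxE s : word_mx s = state_mx (state s).
Proof.
elim/last_ind: s => [|s i IHs].
  rewrite /word_mx big_nil; apply/matrixP => k j; rewrite !mxE.
  by case: (ord2P k) => ->; case: (ord2P j) => ->.
by rewrite word_mx_rcons IHs state_rcons state_mx_step.
Qed.

Lemma state_mx_inj : injective state_mx.
Proof.
move=> m m' /matrixP e.
have := e ord0 ord_max; have := e ord_max ord0; rewrite !mxE /=.
case: (odd _); case: (odd _) => /=; lia.
Qed.

(** Together with [slash_wordE] this shows that 1 | w does not depend on the word chosen for w. *)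
Lemma word_eq_state s t : word_eq s t = (state s == state t).
Proof. by rewrite /word_eq !word_mxE (inj_eq state_mx_inj). Qed.

Fixpoint alt_word (b : bool) n : seq 'I_2 :=
  if n is n'.+1 then rcons (alt_word (~~ b) n') (if b then ord0 else ord_max)
  else [::].

Lemma state_alt_word b n : state (alt_word b n) = if b then n%:Z else - n%:Z.
Proof.
elim: n b => [|n IHn] b; first by case: b.
rewrite /= state_rcons IHn /step; case: b => /=; first by rewrite opprK -PoszD.
by rewrite -opprD -PoszD.
Qed.

Definition word_of (m : int) : seq 'I_2 := alt_word (0 <= m) `|m|.

Lemma state_word_of m : state (word_of m) = m.
Proof. by rewrite state_alt_word; case: m. Qed.

Definition weyl_of (m : int) : weyl := \pi_weyl (word_of m).
Definition weyl_state (w : weyl) : int := state (repr w).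

Lemma weyl_state_pi s : weyl_state (\pi_weyl s) = state s.
Proof. by apply/eqP; rewrite -word_eq_state -eqmodE reprK. Qed.

Lemma weyl_stateK : cancel weyl_state weyl_of.
Proof.
move=> w; rewrite -[RHS]reprK; apply/eqP.
by rewrite eqmodE /= word_eq_state state_word_of.
Qed.

Lemma weyl_ofK : cancel weyl_of weyl_state.
Proof. by move=> m; rewrite weyl_state_pi state_word_of. Qed.

End Weyl.

(** * The sum over W, Delta and the product formula *)

Section MainTheorem.
Variables (R : idomainType) (u : R).

Local Notation x := (var R ord0).
Local Notation y := (var R ord_max).
Local Notation U := (cst u).

Definition weyl_series (w : weyl) : series R :=
  sval (expansion_exists (small_le (leq0n _) (small_term u (weyl_state w)))).

Lemma weyl_series_expansion w : is_expansion (term u (weyl_state w)) (weyl_series w).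
Proof. exact: svalP. Qed.

Lemma weyl_seriesP s : is_expansion (slash_word u 1 s) (weyl_series (\pi_weyl s)).
Proof. by rewrite slash_wordE -weyl_state_pi; apply: weyl_series_expansion. Qed.

(** The elements encoded by -N <= m < N, an asymmetric range that matches the pairs [Epos k],
    [Eneg k.+1]. *)
Definition weyl_list N : seq weyl :=
  map weyl_of (map Posz (iota 0 N) ++ map Negz (iota 0 N)).

Lemma weyl_list_uniq N : uniq (weyl_list N).
Proof.
rewrite (map_inj_uniq (can_inj weyl_ofK)) cat_uniq.
rewrite !map_inj_uniq ?iota_uniq; [|by move=> k l []|by move=> k l []].
by rewrite andbT; apply/hasPn => m /mapP[k _ ->]; apply/mapP => -[].
Qed.

Lemma weyl_list_notin N w : w \notin weyl_list N -> (N <= `|weyl_state w|)%N.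
Proof.
apply: contraR; rewrite -ltnNge => hw; apply/mapP; exists (weyl_state w).
  rewrite mem_cat; case: (weyl_state w) hw => k hk; apply/orP; [left|right];
    apply: map_f; rewrite mem_iota add0n //=; exact: ltnW hk.
by rewrite weyl_stateK.
Qed.

Lemma sum_weyl_list N : \sum_(w <- weyl_list N) term u (weyl_state w) =
  \sum_(k < N) (Epos x y U k + Eneg x y U k.+1).
Proof.
rewrite big_map (eq_bigr (term u)) => [|m _]; last by rewrite weyl_ofK.
rewrite big_cat !big_map big_split -(big_mkord xpredT (Epos x y U)).
by rewrite -(big_mkord xpredT (fun k => Eneg x y U k.+1)) /index_iota subn0.
Qed.

(** Outside the list the term has order at least N by [small_term], so its expansion starts in
    degree N or later. *)
Lemma weyl_series_eq0 N w m :
  w \notin weyl_list N -> (mdeg m < N)%N -> weyl_series w m = 0.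
Proof.
move=> /weyl_list_notin hw hm; have e := approx_expansion N (weyl_series_expansion w).
rewrite (@approx_eq _ N _ _ (series_of 0) m e) ?/series_of ?mcoeff0 //.
apply: approx_congr (approx_poly N 0) _; rewrite tofrac0 sub0r.
exact/smallN/(small_le hw)/small_term.
Qed.

Definition weyl_sum : series R :=
  fun m => \sum_(w <- weyl_list (mdeg m).+1) weyl_series w m.

Lemma stabilizes_weyl_sum N m : (mdeg m < N)%N ->
  stabilizes (fun s : seq weyl => \sum_(w <- s) weyl_series w m)
    (\sum_(w <- weyl_list N) weyl_series w m).
Proof.
move=> hm; apply: (stabilizes_sum (weyl_list_uniq N)) => w hw.
exact: weyl_series_eq0 hw hm.
Qed.

Lemma weyl_sumP : is_sum weyl_series weyl_sum.
Proof. by move=> m; apply: stabilizes_weyl_sum. Qed.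

Lemma approx_weyl_sum d N : (d <= N)%N ->
  approx d (\sum_(k < N) (Epos x y U k + Eneg x y U k.+1)) weyl_sum.
Proof.
move=> dN; rewrite -sum_weyl_list.
apply: approx_ext (approx_sum _ (fun w => approx_expansion d (weyl_series_expansion w))).
move=> m hm; apply: stabilizes_unique (stabilizes_weyl_sum _) (weyl_sumP m).
exact: leq_trans dN.
Qed.

Local Notation p := ('X_[delta *+ 2] : {mpoly R[2]}).

Lemma delta_sqr : p = ('X_ord0 * 'X_ord_max) ^+ 2.
Proof. by rewrite -mpolyXn mpolyXD. Qed.

Lemma tofrac_delta_sqr : p%:F = xdelta2 x y.
Proof. by rewrite delta_sqr tofracXn tofracM. Qed.

Lemma low_X i : low 1 ('X_i : {mpoly R[2]}).
Proof. by have := @low_monomial R U_(i)%MM; rewrite mdeg1. Qed.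

Lemma low_p : low 1 p.
Proof. by rewrite delta_sqr expr2 -mulrA; apply/lowMr/low_X. Qed.

Lemma real_root_monomial i k :
  'X_[real_root (i, k) *+ 2] = 'X_i ^+ 2 * p ^+ k :> {mpoly R[2]}.
Proof. by rewrite -!mpolyXn mpolyXD exprMn -mpolyXn -!exprM mulnC. Qed.

Lemma imaginary_root_monomial k :
  'X_[delta *+ (2 * k.+1)] = p * p ^+ k :> {mpoly R[2]}.
Proof. by rewrite -exprS mpolyXn; congr mpolyX; apply/mnmP => i; rewrite !mulmnE mulnA. Qed.

Definition Dre : series R :=
  lim_prod (fun ik : 'I_2 * nat => 1 - 'X_[real_root ik *+ 2])
    (fun d => [seq (i, k) | i <- enum 'I_2, k <- iota 0 d]).

Let real_roots d := [seq (i, k) | i <- enum 'I_2, k <- iota 0 d].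

Let low_real_root d ik : ik \notin real_roots d ->
  low d (1 - 'X_[real_root ik *+ 2] - 1 : {mpoly R[2]}).
Proof.
case: ik => i k; rewrite real_root_monomial => hik.
apply: low_le (@low_qfactor _ _ _ (lowMr _ (low_X i)) low_p k); apply: leqW.
rewrite leqNgt; apply: contra hik => hk.
by apply/allpairsP; exists (i, k); rewrite mem_enum mem_iota add0n.
Qed.

Let real_roots_uniq d : uniq (real_roots d).
Proof.
by apply: allpairs_uniq => [||[i k] [j l] _ _ []]; rewrite ?enum_uniq ?iota_uniq // => -> ->.
Qed.

Let real_roots_mono d e : (d <= e)%N -> {subset real_roots d <= real_roots e}.
Proof.
move=> de [i k] /allpairsP[[j l] /= [_ hl [-> ->]]].
apply/allpairsP; exists (j, l); split; rewrite ?mem_enum //=.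
by move: hl; rewrite !mem_iota !add0n /= => /leq_trans; apply.
Qed.

Lemma DreP : is_prod (fun ik : 'I_2 * nat => 1 - 'X_[real_root ik *+ 2]) Dre.
Proof. exact: lim_prodP real_roots_uniq low_real_root. Qed.

Lemma approx_Dre d N : (d <= N)%N ->
  approx d (qpoch (xdelta2 x y) (x ^+ 2) N * qpoch (xdelta2 x y) (y ^+ 2) N) Dre.
Proof.
move=> dN; exists (\prod_(ik <- real_roots N) (1 - 'X_[real_root ik *+ 2])); split.
  exact: rep_lim_prod real_roots_uniq low_real_root real_roots_mono _ _ dN.
rewrite [X in _ - X](_ : _ = qpoch (xdelta2 x y) (x ^+ 2) N * qpoch (xdelta2 x y) (y ^+ 2) N).
  by rewrite subrr; apply: small_0.
have e i : (\prod_(k <- iota 0 N) (1 - 'X_[real_root (i, k) *+ 2]) : {mpoly R[2]})%:F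
    = qpoch (xdelta2 x y) (var R i ^+ 2) N.
  rewrite rmorph_prod /qpoch.
  rewrite -(big_mkord xpredT (fun k => 1 - var R i ^+ 2 * xdelta2 x y ^+ k)).
  rewrite /index_iota subn0; apply: eq_bigr => k _.
  by rewrite real_root_monomial /= tofracB tofracM !tofracXn tofrac_delta_sqr.
rewrite big_allpairs big_enum big_ord_recl big_ord1 tofracM !e.
by congr (_ * qpoch _ (var R _ ^+ 2) _); apply: val_inj.
Qed.

Definition Delta_series : series R := series_mul Dre (qprod p p).

Lemma Delta_seriesP : is_Delta Delta_series.
Proof.
exists Dre, (qprod p p); split=> //; first exact: DreP.
apply: is_prod_ext (qprodP low_p low_p) => k.
by rewrite imaginary_root_monomial.
Qed.

Lemma Delta_series_coeff0 : Delta_series 0%MM = 1.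
Proof.
rewrite /Delta_series series_mul_coeff0 (qprod_coeff0 low_p low_p) mulr1.
apply: is_prod_coeff0 DreP _ => -[i k]; rewrite real_root_monomial.
exact: low_le (@low_qfactor _ _ _ (lowMr _ (low_X i)) low_p k).
Qed.

Lemma Delta_unique D : is_Delta D -> D =1 Delta_series.
Proof.
move=> [Dr [Di [hDr hDi eD]]] m; rewrite eD; apply: eq_series_mul.
  exact: is_prod_unique hDr DreP.
apply: is_prod_unique hDi _; apply: is_prod_ext (qprodP low_p low_p) => k.
by rewrite imaginary_root_monomial.
Qed.

Local Notation a := (u *: 'X_ord0 : {mpoly R[2]}).
Local Notation b := (u *: ('X_ord_max * 'X_[delta]) : {mpoly R[2]}).

Lemma low_a : low 1 a.
Proof. by rewrite -mul_mpolyC; apply/lowMl/low_X. Qed.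

Lemma low_b : low 1 b.
Proof. by rewrite -mul_mpolyC; apply/lowMl/lowMr/low_X. Qed.

Lemma approx_PQ d N : (d <= N)%N ->
  approx d (Apart x y U N) (series_mul (qprod a p) (qprod b p)).
Proof.
move=> dN; apply: approx_mul.
  have := approx_qprod low_a low_p dN.
  by rewrite tofrac_delta_sqr -mul_mpolyC tofracM.
have := approx_qprod low_b low_p dN.
rewrite tofrac_delta_sqr -mul_mpolyC !tofracM mpolyXD tofracM.
(* The second parameter agrees because x_0 x_1 ^ 2 = x_1 x^delta. *)
by rewrite (_ : y * (x * y) = x * y ^+ 2) // mulrCA.
Qed.

Lemma approx_Delta d N : (d <= N)%N -> approx d (Dpart x y N) Delta_series.
Proof.
move=> dN; rewrite /Dpart mulrC; apply: approx_mul (approx_Dre dN) _.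
by have := approx_qprod low_p low_p dN; rewrite tofrac_delta_sqr.
Qed.

(** Both sides are approximated by the two rational functions that [limit_congr] compares, which
    decides each coefficient. *)
Lemma weyl_sum_PQ :
  series_mul weyl_sum (series_mul (qprod a p) (qprod b p)) =1 Delta_series.
Proof.
(* d exceeds the degree of m, and N = 2 d meets the bound in [limit_congr]. *)
move=> m; set d := (mdeg m).+1; set N := d.*2.
have dN : (d <= N)%N by rewrite /N -addnn leq_addr.
have dN2 : (d <= N.*2.+1)%N by rewrite leqW // -addnn (leq_trans dN) ?leq_addr.
have hS := approx_mul (approx_weyl_sum dN2) (approx_PQ dN).
apply: (approx_eq (approx_congr hS _) (approx_Delta dN)) => //.
by apply: (limit_congr (var_neq0 R _) (var_neq0 R _) (small_filtration R));
  [apply: small1_var|apply: small1_var|apply: small0_cst|].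
Qed.

Lemma PQ_coeff0 : series_mul (qprod a p) (qprod b p) 0%MM = 1.
Proof.
by rewrite series_mul_coeff0 !qprod_coeff0 ?mulr1; auto using low_a, low_b, low_p.
Qed.

(** The witness is 1 / PQ: multiplying Delta = S PQ by it gives back the sum S over W. *)
Lemma Zomega1_exists : exists Z : series R, is_Zomega1 u Z.
Proof.
set PQ := series_mul (qprod a p) (qprod b p).
exists (series_div (series_of 1) PQ), weyl_series, weyl_sum, Delta_series; split.
- exact: weyl_seriesP.
- exact: weyl_sumP.
- exact: Delta_seriesP.
split; first by rewrite Delta_series_coeff0 unitr1.
move=> m; rewrite -[RHS]series_mul1.
rewrite -(eq_series_mul weyl_sum_PQ (frefl _)) -series_mulA.
apply: eq_series_mul => //; apply: series_divP.
by rewrite PQ_coeff0 unitr1.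
Qed.

(** The data T, S, D behind Z are unique, so Delta (PQ Z) = PQ S = Delta, and Delta can be cancelled
    since its constant term is 1. *)
Lemma Zomega1_inverse Z : is_Zomega1 u Z ->
  series_mul (series_mul (qprod a p) (qprod b p)) Z =1 series_of 1.
Proof.
move=> [T [S [D [hT hS hD [_ hZ]]]]].
have eD := Delta_unique hD.
have eT w : T w =1 weyl_series w.
  rewrite -[w]reprK; apply: expansion_unique (hT _) (weyl_seriesP _).
have eS : S =1 weyl_sum := is_sum_unique eT hS weyl_sumP.
apply: (@series_mul_cancel _ Delta_series); first by rewrite Delta_series_coeff0 unitr1.
move=> m; rewrite series_mulA.
rewrite (eq_series_mul (series_mulC _ _) (frefl Z)) -series_mulA.
rewrite (@eq_series_mul _ _ _ _ weyl_sum (frefl _)); last first.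
  by move=> k; rewrite -(eq_series_mul eD (frefl Z)) hZ eS.
by rewrite series_mulC weyl_sum_PQ series_mul1.
Qed.

End MainTheorem.

Theorem theorem6p3 (R : idomainType) (u : R) :
  (exists Z : series R, is_Zomega1 u Z) /\
  (forall Z : series R, is_Zomega1 u Z ->
     exists P Q : series R,
       [/\ is_qpochhammer (u *: 'X_ord0) 'X_[delta *+ 2] P,
           is_qpochhammer (u *: ('X_ord_max * 'X_[delta])) 'X_[delta *+ 2] Q &
           is_quotient (series_of (1 : {mpoly R[2]})) (series_mul P Q) Z]).
Proof.
split; first exact: Zomega1_exists.
move=> Z hZ; exists (qprod (u *: 'X_ord0) 'X_[delta *+ 2]).
exists (qprod (u *: ('X_ord_max * 'X_[delta])) 'X_[delta *+ 2]); split.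
- exact: qprodP (@low_a _ u) (@low_p R).
- exact: qprodP (@low_b _ u) (@low_p R).
split; first by rewrite PQ_coeff0 unitr1.
exact: Zomega1_inverse.
Qed.
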